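(* Let $\xi,\zeta$ be admissible families with $E[\operatorname{ess\,sup}_{\theta\in\mathcal T}(\xi(\theta))^-]<+\infty$, $E[\operatorname{ess\,sup}_{\theta\in\mathcal T}(\zeta(\theta))^+]<+\infty$ and $\xi(T)=\zeta(T)=0$ a.s., and let $J,J'$ be the associated families. Suppose that $J(0)<+\infty$ and that the families $(\xi(\theta),\theta\in\mathcal T)$ and $(-\zeta(\theta),\theta\in\mathcal T)$ are right-USCE. Then the game is fair and the common value function equals $Y=J-J'$, i.e. for each $\theta\in\mathcal T$, $$Y(\theta)=\underline V(\theta)=\overline V(\theta)\quad\text{a.s.}$$
   Context: Filtered probability space $(\Omega,\mathcal F,(\mathcal F_t)_{0\le t\le T},P)$ satisfying the usual conditions, $\mathcal F=\mathcal F_T$, $\mathcal F_0$ trivial, $T\in(0,\infty)$. $\mathcal T$: stopping times valued in $[0,T]$; $\mathcal T_S=\{\theta\in\mathcal T:\theta\ge S\text{ a.s.}\}$. A family $\phi=(\phi(\theta),\theta\in\mathcal T)$ of $\overline{\mathbb R}$-valued random variables is admissible if each $\phi(\theta)$ is $\mathcal F_\theta$-measurable and $\phi(\theta)=\phi(\theta')$ a.s. on $\{\theta=\theta'\}$. An admissible family $\phi$ with $E[\operatorname{ess\,sup}_\theta\phi(\theta)^-]<\infty$ is right-USCE (right-upper semicontinuous in expectation along stopping times) if for all $\theta\in\mathcal T$ and all sequences $(\theta_n)$ in $\mathcal T$ with $\theta_n\downarrow\theta$, $E[\phi(\theta)]\ge\limsup_nE[\phi(\theta_n)]$. Families $J,J'$: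 $J_0=J'_0=0$, $J_{n+1}(\theta)=\operatorname{ess\,sup}_{\tau\in\mathcal T_\theta}E[J'_n(\tau)+\xi(\tau)\mid\mathcal F_\theta]$, $J'_{n+1}(\theta)=\operatorname{ess\,sup}_{\sigma\in\mathcal T_\theta}E[J_n(\sigma)-\zeta(\sigma)\mid\mathcal F_\theta]$, $J=\limsup_nJ_n$, $J'=\limsup_nJ'_n$ (pointwise in $\theta$); when $J(0)<\infty$, $Y:=J-J'$. Criterion $I_\theta(\tau,\sigma)=E[\xi(\tau)\mathbf 1_{\{\tau\le\sigma\}}+\zeta(\sigma)\mathbf 1_{\{\sigma<\tau\}}\mid\mathcal F_\theta]$ for $(\tau,\sigma)\in\mathcal T_\theta^2$; $\underline V(\theta)=\operatorname{ess\,sup}_{\tau\in\mathcal T_\theta}\operatorname{ess\,inf}_{\sigma\in\mathcal T_\theta}I_\theta(\tau,\sigma)$, $\overline V(\theta)=\operatorname{ess\,inf}_{\sigma\in\mathcal T_\theta}\operatorname{ess\,sup}_{\tau\in\mathcal T_\theta}I_\theta(\tau,\sigma)$. The game is fair if $\underline V(\theta)=\overline V(\theta)$ a.s. for every $\theta$. *)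

(* Defs.v *)
From HB Require Import structures.
From mathcomp Require Import all_boot all_order all_algebra.
From mathcomp Require Import all_classical all_reals all_analysis measurable_realfun.
Set Implicit Arguments. Unset Strict Implicit. Unset Printing Implicit Defensive.
Import Order.TTheory GRing.Theory Num.Theory numFieldNormedType.Exports.
Local Open Scope classical_set_scope.
Local Open Scope ring_scope.

Section Dynkin.
Context {d : measure_display} {Omega : measurableType d} {R : realType}.
Variables (P : probability Omega R) (F : R -> set (set Omega)) (T : R).

Definition usual_filtration : Prop :=
  0 < T /\
  (forall t, 0 <= t <= T -> sigma_algebra setT (F t)) /\
  (forall s t, 0 <= s -> s <= t -> t <= T -> F s `<=` F t) /\
  (forall A, measurable A <-> F T A) /\
  (forall t, 0 <= t -> t < T ->
     forall A, (forall s, t < s -> s <= T -> F s A) -> F t A) /\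
  (forall N, P.-negligible N -> F 0 N) /\
  (forall A, F 0 A -> P A = 0%E \/ P A = 1%E).

Definition stopping_time (th : Omega -> R) : Prop :=
  (forall w, 0 <= th w <= T) /\
  (forall t, 0 <= t -> t <= T -> F t [set w | th w <= t]).

Definition stopping_after (S : Omega -> R) : set (Omega -> R) :=
  [set th | stopping_time th /\ {ae P, forall w, S w <= th w}].

Definition F_at (th : Omega -> R) : set (set Omega) :=
  [set A | measurable A /\
     forall t, 0 <= t -> t <= T -> F t (A `&` [set w | th w <= t])].

Definition meas_wrt (G : set (set Omega)) (X : Omega -> \bar R) : Prop :=
  forall B : set (\bar R), @measurable _ (\bar R) B -> G (X @^-1` B).

(** conditional expectation of a nonnegative r.v. (always exists,
    possibly infinite) *)
Definition cond_exp_nonneg (G : set (set Omega)) (X Y : Omega -> \bar R) : Prop :=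
  meas_wrt G Y /\ (forall w, (0 <= Y w)%E) /\
  (forall A, G A -> (\int[P]_(w in A) Y w = \int[P]_(w in A) X w)%E).

Definition cond_exp (G : set (set Omega)) (X Y : Omega -> \bar R) : Prop :=
  exists Yp Ym, cond_exp_nonneg G X^\+%E Yp /\ cond_exp_nonneg G X^\-%E Ym /\
    {ae P, forall w, Y w = (Yp w - Ym w)%E}.

Definition is_ess_sup {I : Type} (D : set I) (X : I -> Omega -> \bar R)
    (Z : Omega -> \bar R) : Prop :=
  measurable_fun setT Z /\
  (forall i, D i -> {ae P, forall w, (X i w <= Z w)%E}) /\
  (forall Z', measurable_fun setT Z' ->
     (forall i, D i -> {ae P, forall w, (X i w <= Z' w)%E}) ->
     {ae P, forall w, (Z w <= Z' w)%E}).

Definition is_ess_inf {I : Type} (D : set I) (X : I -> Omega -> \bar R)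
    (Z : Omega -> \bar R) : Prop :=
  measurable_fun setT Z /\
  (forall i, D i -> {ae P, forall w, (Z w <= X i w)%E}) /\
  (forall Z', measurable_fun setT Z' ->
     (forall i, D i -> {ae P, forall w, (Z' w <= X i w)%E}) ->
     {ae P, forall w, (Z' w <= Z w)%E}).

Definition admissible (phi : (Omega -> R) -> Omega -> \bar R) : Prop :=
  (forall th, stopping_time th -> meas_wrt (F_at th) (phi th)) /\
  (forall th th', stopping_time th -> stopping_time th' ->
     {ae P, forall w, th w = th' w -> phi th w = phi th' w}).

Definition neg_part_ess_sup_integrable (phi : (Omega -> R) -> Omega -> \bar R) :=
  exists Z, is_ess_sup stopping_time (fun th => (phi th)^\-%E) Z /\
    (\int[P]_w Z w < +oo)%E.

Definition right_USCE (phi : (Omega -> R) -> Omega -> \bar R) : Prop :=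
  admissible phi /\ neg_part_ess_sup_integrable phi /\
  forall th (thn : nat -> Omega -> R), stopping_time th ->
    (forall n, stopping_time (thn n)) ->
    (forall n w, thn n.+1 w <= thn n w) ->
    (forall w, (fun n => thn n w) @ \oo --> (th w : R)) ->
    (limn_esup (fun n => \int[P]_w phi (thn n) w) <= \int[P]_w phi th w)%E.

Definition JJ'_families (xi zeta : (Omega -> R) -> Omega -> \bar R)
    (J J' : nat -> (Omega -> R) -> Omega -> \bar R) : Prop :=
  (forall th w, J 0%N th w = 0%E) /\ (forall th w, J' 0%N th w = 0%E) /\
  (forall n th, stopping_time th ->
     exists C : (Omega -> R) -> Omega -> \bar R,
       (forall tau, stopping_after th tau ->
          cond_exp (F_at th) (fun w => (J' n tau w + xi tau w)%E) (C tau)) /\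
       is_ess_sup (stopping_after th) C (J n.+1 th)) /\
  (forall n th, stopping_time th ->
     exists C : (Omega -> R) -> Omega -> \bar R,
       (forall sigma, stopping_after th sigma ->
          cond_exp (F_at th) (fun w => (J n sigma w - zeta sigma w)%E) (C sigma)) /\
       is_ess_sup (stopping_after th) C (J' n.+1 th)).

Definition payoff (xi zeta : (Omega -> R) -> Omega -> \bar R)
    (tau sigma : Omega -> R) : Omega -> \bar R :=
  fun w => if tau w <= sigma w then xi tau w else zeta sigma w.

Definition criterion_versions (xi zeta : (Omega -> R) -> Omega -> \bar R)
    (th : Omega -> R) (I : (Omega -> R) -> (Omega -> R) -> Omega -> \bar R) :=
  forall tau sigma, stopping_after th tau -> stopping_after th sigma ->
    cond_exp (F_at th) (payoff xi zeta tau sigma) (I tau sigma).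

Definition is_lower_value (th : Omega -> R)
    (I : (Omega -> R) -> (Omega -> R) -> Omega -> \bar R) (V : Omega -> \bar R) :=
  exists Inf : (Omega -> R) -> Omega -> \bar R,
    (forall tau, stopping_after th tau ->
       is_ess_inf (stopping_after th) (fun sigma => I tau sigma) (Inf tau)) /\
    is_ess_sup (stopping_after th) Inf V.

Definition is_upper_value (th : Omega -> R)
    (I : (Omega -> R) -> (Omega -> R) -> Omega -> \bar R) (V : Omega -> \bar R) :=
  exists Sup : (Omega -> R) -> Omega -> \bar R,
    (forall sigma, stopping_after th sigma ->
       is_ess_sup (stopping_after th) (fun tau => I tau sigma) (Sup sigma)) /\
    is_ess_inf (stopping_after th) Sup V.

End Dynkin.

(* Main.v *)
Require Import Defs.
From HB Require Import structures.
From mathcomp Require Import all_boot all_order all_algebra.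
From mathcomp Require Import all_classical all_reals all_analysis measurable_realfun.
From mathcomp Require Import lra.
Import Order.TTheory GRing.Theory Num.Theory numFieldNormedType.Exports.
Local Open Scope classical_set_scope.
Local Open Scope ring_scope.
Set Implicit Arguments. Unset Strict Implicit. Unset Printing Implicit Defensive.

(* Triviality of [F 0] turns [J(0) < oo] into
   integrability of all the families involved.  Then [J] and [J'] are increasing
   limits of the supermartingale families [J_n] and [J'_n], with
   [J'_n + xi <= J_(n+1)] and [J_n - zeta <= J'_(n+1)].

   Fix [tau, sigma >= theta] and let [rho = min tau sigma].  Where [tau <= sigma],
   the payoff is [xi(tau) = (J'_n + xi)(tau) - J'_n(rho)]; elsewhere it is
   [zeta(sigma) >= J_(n+1)(rho) - J'_(n+2)(rho)], and [J_(n+1)(rho)] dominates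
   [E[(J'_n + xi)(tau) | F_rho]].  As [J'_(n+2)] is a supermartingale,
     [I(tau, sigma) >= E[(J'_n + xi)(tau) | F_theta] - J'_(n+2)(theta)],
   whose right-hand side does not involve [sigma].  Symmetrically,
     [I(tau, sigma) <= J_(n+2)(theta) - E[(J_n - zeta)(sigma) | F_theta]].
   Taking essential suprema over [tau] and over [sigma] and letting [n] grow
   squeezes both values onto [J - J']. *)

(** The data present [J n.+1 th] only as an essential supremum of chosen versions of conditional
    expectations. That it is measurable at time [th], agrees with [J n.+1 th'] where [th = th'], and
    is a supermartingale in [th] must all be derived. The source is pasting: two stopping times can
    be combined along a set known at [th], so the versions are upward directed and a single stopping
    time nearly attains the supremum in mean.

    Conditional inequalities are proved by comparing integrals over sets of the sigma-algebra. This
    calls for integrability, which is itself deduced from positivity and monotonicity in [n]; those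
    two are therefore obtained for conditional expectations that may be infinite.

    The shift by two in the index is the cost of two dominations: [J'_n + xi] at [tau] is absorbed
    into [J_(n+1)] at [rho], and [J_(n+1) - zeta] into [J'_(n+2)]. Working with [- zeta] makes the
    players interchangeable, so each fact on envelopes is proved once for a pair of rewards [a],
    [b]. *)

Section complete_subalgebra.
Context {d : measure_display} {Omega : measurableType d} {R : realType}.
Variable P : probability Omega R.
Implicit Types (G : set (set Omega)) (X Y f g : Omega -> \bar R) (A B : set Omega).
Local Open Scope ereal_scope.

(** Conditional expectations and essential suprema are determined only up to null sets; containing
    these sets lets [G]-measurability pass to any a.e. equal version. *)
Definition complete_subalgebra G :=
  [/\ sigma_algebra setT G, G `<=` measurable & P.-negligible `<=` G].

Lemma meas_wrtP G X : sigma_algebra setT G ->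
  meas_wrt G X <-> @measurable_fun _ _ (g_sigma_algebraType G) (\bar R) setT X.
Proof.
move=> sG; split.
  move=> mX _ B mB; rewrite setTI; rewrite /measurable/=.
  by rewrite sigma_algebra_id//; exact: mX.
move=> mX B mB; have := mX measurableT B mB.
by rewrite setTI /measurable/= sigma_algebra_id.
Qed.

Lemma mem_subalgP G A : sigma_algebra setT G ->
  G A <-> measurable (A : set (g_sigma_algebraType G)).
Proof. by move=> sG; rewrite /measurable/= sigma_algebra_id. Qed.

Lemma subalgT G : sigma_algebra setT G -> G setT.
Proof. by move=> sG; apply/mem_subalgP. Qed.

Lemma subalgC G A : sigma_algebra setT G -> G A -> G (~` A).
Proof. by move=> sG /(mem_subalgP _ sG) GA; apply/mem_subalgP => //; exact: measurableC. Qed.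

Lemma subalgI G A B : sigma_algebra setT G -> G A -> G B -> G (A `&` B).
Proof.
move=> sG /(mem_subalgP _ sG) GA /(mem_subalgP _ sG) GB.
by apply/mem_subalgP => //; exact: measurableI.
Qed.

Lemma subalgU G A B : sigma_algebra setT G -> G A -> G B -> G (A `|` B).
Proof.
move=> sG /(mem_subalgP _ sG) GA /(mem_subalgP _ sG) GB.
by apply/mem_subalgP => //; exact: measurableU.
Qed.

Lemma subalg_ae G A B : sigma_algebra setT G -> P.-negligible `<=` G ->
  G A -> {ae P, forall w, A w <-> B w} -> G B.
Proof.
move=> sG Gnull GA AB.
have -> : B = (A `&` ~` (A `\` B)) `|` (B `\` A).
  apply/seteqP; split => w.
    by move=> Bw; have [Aw|nAw] := pselect (A w); [left; split => // -[]|right].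
  by case=> [[Aw /not_andP[//|/contrapT//]]|[]].
apply: subalgU => //; [apply: subalgI => //; apply: subalgC => //|]; apply: Gnull.
  by apply: negligibleS AB => w [Aw nBw] /= [h _]; exact: nBw (h Aw).
by apply: negligibleS AB => w [Bw nAw] /= [_ h]; exact: nAw (h Bw).
Qed.

Lemma meas_wrt_ae G X Y : complete_subalgebra G -> meas_wrt G X ->
  {ae P, forall w, Y w = X w} -> meas_wrt G Y.
Proof.
move=> [sG _ Gnull] mX XY B mB; apply: (subalg_ae sG Gnull (mX _ mB)).
by apply: filterS XY => w /= ->.
Qed.

Lemma meas_wrt_measurable G X : complete_subalgebra G -> meas_wrt G X ->
  measurable_fun setT X.
Proof. by move=> [_ Gm _] mX _ B mB; rewrite setTI; apply: Gm; exact: mX. Qed.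

Lemma subalg_lt G X Y : sigma_algebra setT G -> meas_wrt G X -> meas_wrt G Y ->
  G [set w | X w < Y w].
Proof.
move=> sG /(meas_wrtP _ sG) mX /(meas_wrtP _ sG) mY; apply/mem_subalgP => //.
by rewrite -[X in measurable X]setTI; exact: measurable_lte.
Qed.

Lemma meas_wrtD G X Y : sigma_algebra setT G -> meas_wrt G X -> meas_wrt G Y ->
  meas_wrt G (X \+ Y).
Proof.
move=> sG /(meas_wrtP _ sG) mX /(meas_wrtP _ sG) mY; apply/meas_wrtP => //.
exact: emeasurable_funD.
Qed.

Lemma meas_wrtN G X : sigma_algebra setT G -> meas_wrt G X ->
  meas_wrt G (\- X).
Proof.
move=> sG /(meas_wrtP _ sG) mX; apply/meas_wrtP => //.
exact: measurableT_comp.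
Qed.

Lemma integrableTS A f : measurable A -> P.-integrable setT f ->
  P.-integrable A f.
Proof. by move=> mA; exact: integrableS. Qed.

Lemma ae_le_integral A f g : measurable A ->
  P.-integrable setT f -> P.-integrable setT g ->
  {ae P, forall w, A w -> f w <= g w} ->
  \int[P]_(w in A) f w <= \int[P]_(w in A) g w.
Proof.
move=> mA intf intg [N [mN PN0 fgN]].
rewrite (negligible_integral mN)//; last exact: integrableTS.
rewrite [leRHS](negligible_integral mN)//; last exact: integrableTS.
have mAN : measurable (A `\` N) by exact: measurableD.
apply: le_integral => //; [exact: integrableTS|exact: integrableTS|].
move=> w /[!inE] -[Aw nNw]; apply: contrapT => h; apply: nNw; apply: fgN => /= k.
exact: h (k Aw).
Qed.

Lemma ae_eq_integral_on A f g : measurable A ->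
  measurable_fun setT f -> measurable_fun setT g ->
  {ae P, forall w, A w -> f w = g w} ->
  \int[P]_(w in A) f w = \int[P]_(w in A) g w.
Proof.
by move=> mA mf mg fg; apply: ae_eq_integral => //; exact: measurable_funTS.
Qed.

(** The function [f \- g] is positive on [B] with integral at most [0], so it vanishes a.e. on [B],
    which contradicts strict positivity unless [B] is null. *)
Lemma negligible_integral_lt B f g : measurable B ->
  P.-integrable B f -> P.-integrable B g ->
  (forall w, B w -> g w < f w) ->
  \int[P]_(w in B) f w <= \int[P]_(w in B) g w -> P.-negligible B.
Proof.
move=> mB intf intg gf fg.
have mfg : measurable_fun B (f \- g) by exact/measurable_int/(integrableB mB intf intg).
have /(ae_eq_integral_abs P mB mfg) fg0 : \int[P]_(w in B) `|(f \- g) w| = 0.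
  rewrite (eq_integral (f \- g)); last first.
    by move=> w /[!inE] /gf ?; rewrite gee0_abs// ltW// sube_gt0.
  apply/eqP; rewrite eq_le integralB//; apply/andP; split.
    by rewrite leeBlDr ?add0e// integrable_fin_num.
  rewrite -integralB//; apply: integral_ge0 => w /gf; rewrite -sube_gt0.
  exact: ltW.
apply: negligibleS fg0 => w Bw /= /(_ Bw) h.
by have := gf _ Bw; rewrite -sube_gt0 h ltxx.
Qed.

Lemma ae_le_of_integral A f g : measurable A ->
  P.-integrable setT f -> P.-integrable setT g ->
  \int[P]_(w in A `&` [set w | g w < f w]) f w <=
    \int[P]_(w in A `&` [set w | g w < f w]) g w ->
  {ae P, forall w, A w -> f w <= g w}.
Proof.
move=> mA intf intg fg.
have mB : measurable (A `&` [set w | g w < f w]).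
  by apply: measurable_lte => //; apply: measurable_funTS; apply: measurable_int; eassumption.
have : P.-negligible (A `&` [set w | g w < f w]).
  by apply: (negligible_integral_lt mB _ _ _ fg) => [||w []//]; exact: integrableTS.
apply: negligibleS => w /= /not_implyP[Aw /negP].
by rewrite -ltNge.
Qed.

(** The set where the inequality fails belongs to [G], so it is itself a legitimate test set. This
    is how inequalities between conditional expectations are proved throughout. *)
Lemma ae_le_of_subalg G A f g : complete_subalgebra G -> G A ->
  meas_wrt G f -> meas_wrt G g ->
  P.-integrable setT f -> P.-integrable setT g ->
  (forall B, G B -> B `<=` A -> \int[P]_(w in B) f w <= \int[P]_(w in B) g w) ->
  {ae P, forall w, A w -> f w <= g w}.
Proof.
move=> [sG Gm _] GA mf mg intf intg fg; apply: ae_le_of_integral => //.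
  exact: Gm.
by apply: fg => [|w []//]; apply: subalgI => //; exact: subalg_lt.
Qed.

(* Truncating at [Y' <= k] makes both integrals finite, so no integrability is
   needed. *)
Lemma cond_exp_nonneg_le G X X' Y Y' : complete_subalgebra G ->
  measurable_fun setT X -> measurable_fun setT X' ->
  (forall w, 0 <= X w) -> (forall w, 0 <= X' w) ->
  cond_exp_nonneg P G X Y -> cond_exp_nonneg P G X' Y' ->
  {ae P, forall w, X w <= X' w} -> {ae P, forall w, Y w <= Y' w}.
Proof.
move=> cG mX mX' X0 X'0 [GY [Y0 YX]] [GY' [Y'0 YX']] XX'.
have [sG Gm _] := cG.
pose B k := [set w | Y' w < Y w] `&` [set w | Y' w < k%:R%:E].
have GB k : G (B k).
  apply: subalgI => //; apply: subalg_lt => //.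
  by apply/meas_wrtP => //; exact: measurable_cst.
have mY := meas_wrt_measurable cG GY; have mY' := meas_wrt_measurable cG GY'.
have : P.-negligible (\bigcup_k B k).
  apply: negligible_bigcup => k; have mB := Gm _ (GB k).
  have le : \int[P]_(w in B k) Y w <= \int[P]_(w in B k) Y' w.
    rewrite (YX _ (GB k)) (YX' _ (GB k)); apply: ae_ge0_le_integral => //.
    - exact: measurable_funTS.
    - exact: measurable_funTS.
    - by apply: filterS XX' => w.
  have fin : \int[P]_(w in B k) Y' w < +oo.
    apply: (@le_lt_trans _ _ (\int[P]_(w in B k) (cst k%:R%:E) w)).
      apply: ge0_le_integral => //; first exact: measurable_funTS.
      by move=> w [_ /ltW].
    rewrite integral_cst//; apply: (@le_lt_trans _ _ (k%:R%:E * 1)).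
      by rewrite lee_wpmul2l ?lee_fin// probability_le1.
    by rewrite mule1 ltry.
  apply: (negligible_integral_lt mB _ _ _ le) => [||w []//]; apply/integrableP; split.
  - exact: measurable_funTS.
  - apply: le_lt_trans fin; rewrite (eq_integral Y)// => w _.
    by rewrite gee0_abs.
  - exact: measurable_funTS.
  - apply: le_lt_trans fin; rewrite (eq_integral Y')// => w _.
    by rewrite gee0_abs.
apply: negligibleS => w /= /negP; rewrite -ltNge => lt.
have Yfin : Y' w \is a fin_num by rewrite ge0_fin_numE// (lt_le_trans lt)// leey.
exists (Num.truncn (fine (Y' w))).+1 => //; split => //=.
by rewrite -(fineK Yfin) lte_fin truncnS_gt.
Qed.

(** Positive and negative parts are compared separately, so infinite values are allowed; the
    envelopes are compared this way before they are known to be integrable. *)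
Lemma cond_exp_le G X X' Y Y' : complete_subalgebra G ->
  measurable_fun setT X -> measurable_fun setT X' ->
  cond_exp P G X Y -> cond_exp P G X' Y' ->
  {ae P, forall w, X w <= X' w} -> {ae P, forall w, Y w <= Y' w}.
Proof.
move=> cG mX mX' [Yp [Ym [cp [cm YE]]]] [Yp' [Ym' [cp' [cm' YE']]]] XX'.
have lep : {ae P, forall w, Yp w <= Yp' w}.
  apply: (cond_exp_nonneg_le cG _ _ _ _ cp cp') => //; try exact: measurable_funepos.
  by apply: filterS XX' => w ?; rewrite !funeposE le_max2.
have lem : {ae P, forall w, Ym' w <= Ym w}.
  apply: (cond_exp_nonneg_le cG _ _ _ _ cm' cm) => //; try exact: measurable_funeneg.
  by apply: filterS XX' => w ?; rewrite !funenegE le_max2 ?leeN2.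
have : {ae P, forall w, Yp w - Ym w <= Yp' w - Ym' w}.
  by move: lep lem; apply: filterS2 => w; exact: leeB.
by move: YE YE'; apply: filterS3 => w -> ->.
Qed.

(** The usual characterization of the conditional expectation of an integrable variable, without the
    split into two nonnegative parts. *)
Definition integrable_cond_exp G X Y :=
  [/\ meas_wrt G Y, P.-integrable setT Y &
    forall A, G A -> \int[P]_(w in A) Y w = \int[P]_(w in A) X w].

Lemma ge0_integrable f : measurable_fun setT f -> (forall w, 0 <= f w) ->
  \int[P]_w f w < +oo -> P.-integrable setT f.
Proof.
move=> mf f0 fin; apply/integrableP; split => //; apply: le_lt_trans fin.
by rewrite (eq_integral f)// => w _; rewrite gee0_abs.
Qed.

Lemma integrable_ae_eq f g : P.-integrable setT f -> measurable_fun setT g ->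
  {ae P, forall w, f w = g w} -> P.-integrable setT g.
Proof.
move=> /integrableP[mf fi] mg fg; apply/integrableP; split => //.
apply: le_lt_trans fi; rewrite (ae_eq_integral_on _ _ (g := abse \o f))//.
- exact: measurableT_comp.
- exact: measurableT_comp.
- by apply: filterS fg => w /= ->.
Qed.

Lemma integrable_cond_expP G X Y : complete_subalgebra G ->
  P.-integrable setT X -> cond_exp P G X Y -> integrable_cond_exp G X Y.
Proof.
move=> cG intX [Yp [Ym [[Gp [p0 pE]] [[Gm [m0 mE]] YE]]]].
have [sG Gmeas _] := cG.
have mp := meas_wrt_measurable cG Gp; have mm := meas_wrt_measurable cG Gm.
have ip : P.-integrable setT Yp.
  apply: ge0_integrable => //; rewrite pE; last exact: subalgT.
  exact: integral_funepos_lt_pinfty.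
have im : P.-integrable setT Ym.
  apply: ge0_integrable => //; rewrite mE; last exact: subalgT.
  exact: integral_funeneg_lt_pinfty.
have GY : meas_wrt G Y.
  by apply: (meas_wrt_ae cG _ YE); apply: meas_wrtD => //; exact: meas_wrtN.
have mY := meas_wrt_measurable cG GY.
have ipm : P.-integrable setT (Yp \- Ym) by exact: integrableB.
split => //.
  by apply: (integrable_ae_eq ipm) => //; apply: filterS YE => w ->.
move=> A GA; have mA := Gmeas _ GA.
rewrite (ae_eq_integral_on mA mY (measurable_int P ipm)); last first.
  by apply: filterS YE => w.
rewrite integralB//; [|exact: integrableTS..].
by rewrite pE// mE// -integralE.
Qed.

End complete_subalgebra.

(** * Essential suprema of upward directed families *)

Section ess_sup_directed.
Context {d : measure_display} {Omega : measurableType d} {R : realType}.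
Variable P : probability Omega R.
Implicit Types (G : set (set Omega)) (X Y f g : Omega -> \bar R) (A B : set Omega).
Local Open Scope ereal_scope.

Lemma nondecreasing_limn_esup (u : (\bar R)^nat) :
  {homo u : n m / (n <= m)%N >-> n <= m} -> limn_esup u = ereal_sup (range u).
Proof.
move=> ndu; rewrite is_cvg_limn_esupE; last exact: ereal_nondecreasing_is_cvgn.
by apply: cvg_lim => //; exact: ereal_nondecreasing_cvgn.
Qed.

Lemma integral_limn_esup_le (g : (Omega -> \bar R)^nat) (c : \bar R) :
  (forall n, measurable_fun setT (g n)) -> (forall n w, 0 <= g n w) ->
  (forall w, {homo g ^~ w : n m / (n <= m)%N >-> n <= m}) ->
  (forall n, \int[P]_w g n w <= c) ->
  \int[P]_w limn_esup (g ^~ w) <= c.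
Proof.
move=> mg g0 ndg gc.
rewrite (eq_integral (fun w => limn (g ^~ w))); last first.
  by move=> w _; rewrite is_cvg_limn_esupE//; exact: ereal_nondecreasing_is_cvgn.
rewrite monotone_convergence//.
apply: lime_le; last exact: nearW.
apply: ereal_nondecreasing_is_cvgn => n m nm; apply: ge0_le_integral => //.
by move=> w _; exact: ndg.
Qed.

Lemma limn_esup_ge (u : (\bar R)^nat) n :
  {homo u : n m / (n <= m)%N >-> n <= m} -> u n <= limn_esup u.
Proof.
by move=> ndu; rewrite nondecreasing_limn_esup//; apply: ereal_sup_ubound; exists n.
Qed.

Lemma limn_esup_le (u : (\bar R)^nat) c :
  {homo u : n m / (n <= m)%N >-> n <= m} -> (forall n, u n <= c) ->
  limn_esup u <= c.
Proof.
move=> ndu uc; rewrite nondecreasing_limn_esup//; apply: ge_ereal_sup.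
by move=> _ [n _ <-].
Qed.

(** Let [s] be the supremum of the means of the family. Running maxima along a maximizing sequence
    increase to some [W]; directedness puts each of them below one member, so [W] has mean [s]. Any
    [C i] exceeding [W] on a set of positive measure would push the mean above [s]. Hence [Z = W]
    a.e., which gives both the [G]-measurability and the approximation in mean. *)
Lemma ess_sup_directed G (I : Type) (D : set I) (C : I -> Omega -> \bar R) Z i0 :
  complete_subalgebra P G ->
  is_ess_sup P D C Z -> P.-integrable setT Z ->
  (forall i, D i -> meas_wrt G (C i)) ->
  (forall i, D i -> P.-integrable setT (C i)) ->
  D i0 -> {ae P, forall w, 0 <= C i0 w} ->
  (forall i j, D i -> D j -> exists2 k, D k &
    {ae P, forall w, maxe (C i w) (C j w) <= C k w}) ->
  meas_wrt G Z /\
  forall e : R, (0 < e)%R -> exists2 i, D i & \int[P]_w Z w <= \int[P]_w C i w + e%:E.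
Proof.
move=> cG [mZ [Zub Zmin]] iZ GC iC Di0 C0 dir.
have [sG _ _] := cG.
pose s := ereal_sup [set \int[P]_w C i w | i in D].
have CZ i : D i -> \int[P]_w C i w <= \int[P]_w Z w.
  move=> Di; apply: ae_le_integral => //; first exact: iC.
  by apply: filterS (Zub _ Di) => w.
have sub i : D i -> \int[P]_w C i w <= s.
  by move=> Di; apply: ereal_sup_ubound; exists i.
have sfin : s \is a fin_num.
  rewrite fin_numElt; apply/andP; split.
    apply: lt_le_trans (sub _ Di0).
    by have := integrable_fin_num measurableT (iC _ Di0); rewrite fin_numElt => /andP[].
  apply: (@le_lt_trans _ _ (\int[P]_w Z w)); last exact: integrable_lty.
  by apply: ge_ereal_sup => _ [i Di <-]; exact: CZ.
have adh (e : R) : (0 < e)%R -> exists2 i, D i & s - e%:E < \int[P]_w C i w.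
  by move=> e0; have [_ [i Di <-] lt] := ub_ereal_sup_adherent e0 sfin; exists i.
have /choice[i_ i_P] (k : nat) : exists i, D i /\ s - (k.+1%:R^-1)%:E < \int[P]_w C i w.
  have [|i Di lt] := adh (k.+1%:R^-1)%R; first by rewrite invr_gt0 ltr0n.
  by exists i.
pose h n w := iteri n (fun k x => maxe x (C (i_ k) w)) 0.
have hS n w : h n.+1 w = maxe (h n w) (C (i_ n) w) by [].
have ndh w : {homo h ^~ w : n m / (n <= m)%N >-> n <= m}.
  by apply/nondecreasing_seqP => n; rewrite hS le_max lexx.
have h0 n w : 0 <= h n w.
  by elim: n => [//|n IH]; rewrite hS le_max IH.
have Gh n : meas_wrt G (h n).
  apply/meas_wrtP => //; elim: n => [|n IH].
    by rewrite (_ : h 0%N = cst 0)//.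
  rewrite (_ : h n.+1 = fun w => maxe (h n w) (C (i_ n) w)); last exact/funext.
  by apply: measurable_maxe => //; apply/meas_wrtP => //; apply: GC; case: (i_P n).
have mh n := meas_wrt_measurable cG (Gh n).
have hC n : exists2 j, D j & {ae P, forall w, h n w <= C j w}.
  elim: n => [|n [j Dj hj]].
    by exists i0 => //; apply: filterS C0.
  have [k Dk jk] := dir _ _ Dj (proj1 (i_P n)).
  exists k => //; move: hj jk; apply: filterS2 => w hj jk; rewrite hS.
  by apply: le_trans jk; rewrite ge_max !le_max hj lexx orbT.
have le_s g j : measurable_fun setT g -> (forall w, 0 <= g w) -> D j ->
    {ae P, forall w, g w <= C j w} -> \int[P]_w g w <= s.
  move=> mg g0 Dj gj; apply: (le_trans _ (sub _ Dj)).
  apply: (@le_trans _ _ (\int[P]_w maxe (C j w) 0)).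
    apply: ae_ge0_le_integral => //.
    - by move=> w _; rewrite le_max lexx orbT.
    - by apply: measurable_maxe => //; exact/(meas_wrt_measurable cG)/GC.
    - by apply: filterS gj => w ? _; rewrite le_max; apply/orP; left.
  rewrite (ae_eq_integral_on _ _ (g := C j))//.
  - by apply: measurable_maxe => //; exact/(meas_wrt_measurable cG)/GC.
  - exact/(meas_wrt_measurable cG)/GC.
  - by apply: filterS gj => w ? _; apply/max_idPl; apply: le_trans (g0 w) _.
pose W w := limn_esup (h ^~ w).
have GW : meas_wrt G W.
  by apply/meas_wrtP => //; apply: measurable_fun_limn_esup => n; apply/meas_wrtP.
have mW := meas_wrt_measurable cG GW.
have hW n w : h n w <= W w by apply: (limn_esup_ge (u := h ^~ w)).
have W0 w : 0 <= W w by apply: le_trans (hW 0%N w).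
have Ws : \int[P]_w W w <= s.
  by apply: integral_limn_esup_le => // n; have [j Dj hj] := hC n; exact: le_s hj.
have iW : P.-integrable setT W.
  by apply: ge0_integrable => //; apply: le_lt_trans Ws _; rewrite ltey_eq sfin.
have sW : s <= \int[P]_w W w.
  apply/lee_addgt0Pr => e e0; pose k := Num.truncn (e^-1)%R.
  have ke : (k.+1%:R^-1 <= e)%R.
    by rewrite -[leRHS]invrK lef_pV2 ?posrE ?invr_gt0// ltW// truncnS_gt.
  have [Dk lt] := i_P k; rewrite -leeBlDr//.
  apply: (@le_trans _ _ (s - (k.+1%:R^-1)%:E)).
    by rewrite leeB// lee_fin.
  apply/ltW/(lt_le_trans lt); apply: ae_le_integral => //; first exact: iC.
  apply: aeW => w _; apply: le_trans (hW k.+1 w).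
  by rewrite hS le_max lexx orbT.
have CW i : D i -> {ae P, forall w, C i w <= W w}.
  (* Joining [C i] to the running maxima keeps them below members of the family, so the enlarged
     limit [W'] still has mean at most [s]. Since [W <= W'] and [W] already has mean [s], the two
     agree a.e. *)
  move=> Di; pose g n w := maxe (C i w) (h n w).
  have ndg w : {homo g ^~ w : n m / (n <= m)%N >-> n <= m}.
    by move=> n m nm; rewrite /g le_max2// ndh.
  have mg n : measurable_fun setT (g n).
    by apply: measurable_maxe => //; exact/(meas_wrt_measurable cG)/GC.
  have g0 n w : 0 <= g n w by rewrite /g le_max h0 orbT.
  pose W' w := limn_esup (g ^~ w).
  have gW' n w : g n w <= W' w by apply: (limn_esup_ge (u := g ^~ w)).
  have W's : \int[P]_w W' w <= s.
    apply: integral_limn_esup_le => // n; have [j Dj hj] := hC n.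
    have [k Dk ijk] := dir _ _ Di Dj; apply: (le_s _ k) => //.
    move: hj ijk; apply: filterS2 => w hj; apply: le_trans.
    by rewrite le_max2.
  have mW' : measurable_fun setT W' by exact: measurable_fun_limn_esup.
  have W'0 w : 0 <= W' w by apply: le_trans (gW' 0%N w).
  have iW' : P.-integrable setT W'.
    by apply: ge0_integrable => //; apply: le_lt_trans W's _; rewrite ltey_eq sfin.
  have WW' w : W w <= W' w.
    apply: limn_esup_le => // n; apply: le_trans (gW' n w).
    by rewrite le_max lexx orbT.
  have : {ae P, forall w, setT w -> W' w <= W w}.
    apply: ae_le_of_integral => //; rewrite setTI.
    set B := [set w | W w < W' w].
    have mB : measurable B by rewrite -[B]setTI; exact: measurable_lte.
    have mC : measurable (~` B) by exact: measurableC.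
    have splitT f : measurable_fun setT f -> (forall w, 0 <= f w) ->
        \int[P]_w f w = \int[P]_(w in B) f w + \int[P]_(w in ~` B) f w.
      move=> mf f0; rewrite -ge0_integral_setU// ?setUv//.
      by apply/disj_setPS => w [].
    have eqC : \int[P]_(w in ~` B) W' w = \int[P]_(w in ~` B) W w.
      apply: eq_integral => w /[!inE] /negP; rewrite -leNgt => W'W.
      by apply/eqP; rewrite eq_le W'W WW'.
    have := le_trans W's sW; rewrite (splitT _ mW' W'0) (splitT _ mW W0) eqC.
    rewrite leeD2rE//; apply: integrable_fin_num => //; exact: integrableTS.
  apply: filterS => w /(_ Logic.I); apply: le_trans; apply: le_trans (gW' 0%N w).
  by rewrite le_max lexx.
have ZW : {ae P, forall w, Z w <= W w} by exact: Zmin.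
have WZ : {ae P, forall w, W w <= Z w}.
  have : {ae P, forall w, forall n, h n w <= Z w}.
    apply: ae_foralln => n; have [j Dj hj] := hC n.
    by move: hj (Zub _ Dj); apply: filterS2 => w; exact: le_trans.
  by apply: filterS => w hZ; exact: limn_esup_le.
have ZeW : {ae P, forall w, Z w = W w}.
  by move: ZW WZ; apply: filterS2 => w ? ?; apply/eqP; rewrite eq_le; apply/andP.
split; first exact: meas_wrt_ae ZeW.
move=> e e0; have [i Di lt] := adh _ e0; exists i => //.
rewrite (ae_eq_integral_on _ mZ mW)//; last by apply: filterS ZeW.
by apply: (le_trans Ws); rewrite -leeBlDr// ltW.
Qed.

End ess_sup_directed.

(** * Stopping times *)

Section stopping_times.
Context {d : measure_display} {Omega : measurableType d} {R : realType}.
Variables (P : probability Omega R) (F : R -> set (set Omega)) (T : R).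
Hypothesis hF : usual_filtration P F T.
Implicit Types (th tau sigma rho : Omega -> R) (A B : set Omega).

Let T0 : 0 < T. Proof. by case: hF. Qed.

Let sF t : 0 <= t -> t <= T -> sigma_algebra setT (F t).
Proof. by case: hF => _ [h _] t0 tT; apply: h; rewrite t0 tT. Qed.

Let F_mono s t : 0 <= s -> s <= t -> t <= T -> F s `<=` F t.
Proof. by case: hF => _ [_ [h _]]; exact: h. Qed.

Let F_negligible t : 0 <= t -> t <= T -> P.-negligible `<=` F t.
Proof.
move=> t0 tT N /(proj1 (proj2 (proj2 (proj2 (proj2 (proj2 hF)))))).
exact: F_mono.
Qed.

Let F_measurable t : 0 <= t -> t <= T -> F t `<=` measurable.
Proof.
by move=> t0 tT A /(F_mono t0 tT (lexx _)); case: hF => _ [_ [_ [h _]]] /h.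
Qed.

Lemma cst_stopping_time c : 0 <= c -> c <= T -> stopping_time F T (fun=> c).
Proof.
move=> c0 cT; split => [w|t t0 tT]; first by rewrite c0 cT.
have [ct|tc] := leP c t.
  rewrite (_ : [set _ | _] = setT); first exact: subalgT (sF _ _).
  by apply/seteqP; split.
rewrite (_ : [set _ | _] = set0); first by case: (sF t0 tT).
by apply/seteqP; split => // w /=; rewrite leNgt tc.
Qed.

Lemma stopping_time_min tau sigma : stopping_time F T tau ->
  stopping_time F T sigma -> stopping_time F T (fun w => Num.min (tau w) (sigma w)).
Proof.
move=> [tau1 tau2] [sigma1 sigma2]; split => [w|t t0 tT].
  by rewrite /Num.min; case: ifP.
rewrite (_ : [set w | _] = [set w | tau w <= t] `|` [set w | sigma w <= t]).
  by apply: subalgU; [exact: sF|exact: tau2|exact: sigma2].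
by apply/seteqP; split => w /=; rewrite ge_min => /orP.
Qed.

(* A rational (or [t] itself) separates [sigma w] from [tau w]. *)
Lemma stopping_time_lt_le sigma tau t : stopping_time F T sigma ->
  stopping_time F T tau -> 0 <= t -> t <= T ->
  F t ([set w | sigma w < tau w] `&` [set w | sigma w <= t]).
Proof.
move=> [sigma1 sigma2] [tau1 tau2] t0 tT.
pose q_ n : R := if (unpickle n : option rat) is Some q then
   if 0 <= (ratr q : R) <= t then ratr q else t else t.
have q_t n : 0 <= q_ n <= t.
  rewrite /q_; case: (unpickle n) => [q|]; last by rewrite t0 lexx.
  by case: ifP => //; rewrite t0 lexx.
have -> : [set w | sigma w < tau w] `&` [set w | sigma w <= t] =
    \bigcup_n ([set w | sigma w <= q_ n] `&` ~` [set w | tau w <= q_ n]).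
  apply/seteqP; split => w /=.
    move=> [st sigmat]; have [taut|ttau] := leP (tau w) t.
      have [q] := rat_in_itvoo st; rewrite in_itv/= => /andP[sq qt].
      have qP : 0 <= (ratr q : R) <= t.
        have /andP[s0 _] := sigma1 w.
        by rewrite (le_trans s0 (ltW sq)) (le_trans (ltW qt)).
      exists (pickle q) => //; rewrite /q_ pickleK qP; split; first exact: ltW.
      by apply/negP; rewrite -ltNge.
    have [n qn] : exists n, q_ n = t.
      exists (pickle (-1 : rat)); rewrite /q_ pickleK; case: ifP => // /andP[].
      by rewrite rmorphN1 oppr_ge0 ler10.
    by exists n => //; rewrite qn; split => //; apply/negP; rewrite -ltNge.
  move=> [n _ [sq /negP]]; rewrite -ltNge => qtau; split.
    exact: le_lt_trans sq qtau.
  by apply: (le_trans sq); have /andP[] := q_t n.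
have [_ _ FU] := sF t0 tT; apply: FU => n.
have /andP[q0 qt] := q_t n; apply: (F_mono q0 qt tT).
have qT := le_trans qt tT.
apply: subalgI; [exact: sF|exact: sigma2|].
by apply: subalgC; [exact: sF|exact: tau2].
Qed.

Lemma stopping_time_le_measurable tau t : stopping_time F T tau ->
  measurable [set w | tau w <= t].
Proof.
move=> [tau1 tau2]; have [tT|Tt] := leP t T; last first.
  rewrite (_ : [set _ | _] = setT) //; apply/seteqP; split => // w _ /=.
  by have /andP[_ h] := tau1 w; exact: le_trans h (ltW Tt).
have [t0|t0] := leP 0 t; first exact: F_measurable (tau2 _ t0 tT).
rewrite (_ : [set _ | _] = set0) //; apply/seteqP; split => // w /= tw.
by have /andP[h _] := tau1 w; have := lt_le_trans (le_lt_trans tw t0) h; rewrite ltxx.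
Qed.

Lemma F_at_complete th : stopping_time F T th ->
  complete_subalgebra P (F_at F T th).
Proof.
move=> [th1 th2]; split.
- split.
  + by split => // t t0 tT; rewrite set0I; case: (sF t0 tT).
  + move=> A [mA FA]; split; first by rewrite setTD; exact: measurableC.
    move=> t t0 tT; rewrite setTD.
    rewrite (_ : _ `&` _ = [set w | th w <= t] `&` ~` (A `&` [set w | th w <= t])).
      apply: subalgI; [exact: sF|exact: th2|].
      by apply: subalgC; [exact: sF|exact: FA].
    by apply/seteqP; split => w /= [h1 h2]; split => //; [case|move=> Aw; apply: h2].
  + move=> A FA; split; first by apply: bigcupT_measurable => n; case: (FA n).
    move=> t t0 tT; rewrite setI_bigcupl; have [_ _ FU] := sF t0 tT.
    by apply: FU => n; case: (FA n) => _; exact.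
- by move=> A [].
- move=> N N0; split; first exact: F_measurable (ltW T0) (lexx _) _ (F_negligible (ltW T0) (lexx _) N0).
  move=> t t0 tT; apply: F_negligible => //.
  by apply: negligibleS N0 => w [].
Qed.

(** The order of the two times is only a.e., so intersecting with [th w <= t] changes the set [A],
    cut at [rho w <= t], by a null set, and [F t] contains the null sets. *)
Lemma F_at_le th rho : stopping_time F T th -> stopping_time F T rho ->
  {ae P, forall w, th w <= rho w} -> F_at F T th `<=` F_at F T rho.
Proof.
move=> [th1 th2] [rho1 rho2] thrho A [mA FA]; split => // t t0 tT.
apply: (subalg_ae (sF t0 tT) (F_negligible t0 tT)
  (A := A `&` [set w | th w <= t] `&` [set w | rho w <= t])).
  by apply: subalgI; [exact: sF|exact: FA|exact: rho2].
apply: filterS thrho => w le; split => /=; first by move=> [[]].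
by move=> [Aw rt]; split => //; split => //; exact: le_trans rt.
Qed.

(** Where [sigma < tau] the minimum is [sigma], which reduces the claim to [stopping_time_lt_le].
    Who stops earlier is thus known when the game ends. *)
Lemma F_at_lt_min sigma tau : stopping_time F T sigma -> stopping_time F T tau ->
  F_at F T (fun w => Num.min (tau w) (sigma w)) [set w | sigma w < tau w].
Proof.
move=> ss st; have FL t : 0 <= t -> t <= T ->
    F t ([set w | sigma w < tau w] `&` [set w | Num.min (tau w) (sigma w) <= t]).
  move=> t0 tT; have := stopping_time_lt_le ss st t0 tT; congr (F t _).
  by apply/seteqP; split => w /= [h1 h2]; split => //; move: h2; rewrite (min_idPr (ltW h1)).
split; last exact: FL.
have := F_measurable (ltW T0) (lexx _) (FL T (ltW T0) (lexx _)); congr measurable.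
apply/seteqP; split => w /=; [by case|move=> h; split => //].
by have [+ _] := ss => /(_ w) /andP[_ ?]; rewrite ge_min; apply/orP; right.
Qed.

Lemma F_at_eqS th th' B : B `<=` [set w | th w = th' w] ->
  F_at F T th B -> F_at F T th' B.
Proof.
move=> Beq [mB FB]; split => // t t0 tT; have := FB t t0 tT; congr (F t _).
by apply/seteqP; split => w /= [Bw]; rewrite (Beq _ Bw).
Qed.

Lemma F_at_eq th th' : stopping_time F T th -> stopping_time F T th' ->
  F_at F T th [set w | th w = th' w].
Proof.
move=> sth sth'.
have smin := stopping_time_min sth sth'.
have minP : F_at F T (fun w => Num.min (th w) (th' w)) [set w | th w = th' w].
  have [sG _ _] := F_at_complete smin.
  rewrite (_ : [set w | th w = th' w] =
    ~` [set w | th' w < th w] `&` ~` [set w | th w < th' w]); last first.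
    apply/seteqP; split => w /=; first by move=> ->; rewrite ltxx.
    by move=> [/negP + /negP]; rewrite -!leNgt => ? ?; apply/eqP; rewrite eq_le; apply/andP.
  apply: subalgI => //; apply: subalgC => //; first exact: F_at_lt_min.
  rewrite (_ : (fun w => _) = (fun w => Num.min (th' w) (th w))); last first.
    by apply/funext => w; rewrite minC.
  exact: F_at_lt_min.
apply: F_at_le minP => //; apply: aeW => w.
by rewrite ge_min lexx.
Qed.

Definition paste A tau tau' : Omega -> R :=
  fun w => if `[< A w >] then tau w else tau' w.

(** The choice between [tau] and [tau'] depends on [A], which is known at [th] and hence, up to null
    sets, before either time. *)
Lemma paste_stopping_after th tau tau' A : stopping_time F T th ->
  F_at F T th A -> stopping_after P F T th tau -> stopping_after P F T th tau' ->
  stopping_after P F T th (paste A tau tau').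
Proof.
move=> sth FA [st tht] [st' tht'].
have FtA : F_at F T tau A by exact: F_at_le FA.
have Ft'A : F_at F T tau' (~` A).
  apply: (F_at_le sth) => //; have [sG _ _] := F_at_complete sth.
  exact: subalgC.
split; last first.
  by move: tht tht'; apply: filterS2 => w ? ?; rewrite /paste; case: ifP.
have [t1 _] := st; have [t1' _] := st'.
split => [w|t t0 tT]; first by rewrite /paste; case: ifP.
rewrite (_ : [set w | _] = (A `&` [set w | tau w <= t]) `|`
  (~` A `&` [set w | tau' w <= t])).
  apply: subalgU; [exact: sF|by case: FtA => _; exact|by case: Ft'A => _; exact].
apply/seteqP; split => w /=; rewrite /paste.
  by case: asboolP => Aw; [left|right].
by case: asboolP => Aw [[]|[]].
Qed.

Lemma pasteT A tau tau' w : A w -> paste A tau tau' w = tau w.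
Proof. by move=> Aw; rewrite /paste asboolT. Qed.

Lemma pasteN A tau tau' w : ~ A w -> paste A tau tau' w = tau' w.
Proof. by move=> nAw; rewrite /paste asboolF. Qed.

Lemma stopping_afterT th : stopping_time F T th ->
  stopping_after P F T th (fun=> T).
Proof.
move=> [th1 _]; split; first exact: cst_stopping_time (ltW T0) (lexx _).
by apply: aeW => w; have /andP[] := th1 w.
Qed.

Lemma stopping_after_refl th : stopping_time F T th -> stopping_after P F T th th.
Proof. by move=> sth; split => //; apply: aeW. Qed.

Lemma stopping_after0 th : stopping_time F T th ->
  stopping_after P F T (fun=> 0) th.
Proof. by move=> sth; split => //; have [th1 _] := sth; apply: aeW => w; case/andP: (th1 w). Qed.

Lemma stopping_after_min th tau sigma : stopping_after P F T th tau ->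
  stopping_after P F T th sigma ->
  stopping_after P F T th (fun w => Num.min (tau w) (sigma w)).
Proof.
move=> [st tht] [ss ths]; split; first exact: stopping_time_min.
by move: tht ths; apply: filterS2 => w ? ?; rewrite le_min; apply/andP.
Qed.

(* The sets [X > k] decrease to a null set and have probability [0] or [1]. *)
Lemma F_at0_bounded (X : Omega -> \bar R) :
  meas_wrt (F_at F T (fun=> 0)) X -> {ae P, forall w, (X w < +oo)%E} ->
  exists c : R, {ae P, forall w, (X w <= c%:E)%E}.
Proof.
move=> GX Xoo; have s0 := cst_stopping_time (lexx 0) (ltW T0).
have cG := F_at_complete s0; have [sG Gm _] := cG.
pose B (k : nat) := [set w | (k%:R%:E < X w)%E].
have GB k : F_at F T (fun=> 0) (B k).
  by apply: subalg_lt => //; apply/meas_wrtP => //; exact: measurable_cst.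
have F0 A : F_at F T (fun=> 0) A -> P A = 0%E \/ P A = 1%E.
  move=> [_ /(_ 0 (lexx _) (ltW T0))]; rewrite (_ : _ `&` _ = A); last first.
    by apply/seteqP; split => w /=; [case|].
  by case: hF => _ [_ [_ [_ [_ [_ h]]]]]; exact: h.
have [[k Bk0]|none] := pselect (exists k, P (B k) = 0%E).
  exists k%:R; apply: negligibleS (_ : P.-negligible (B k)).
    by move=> w /= /negP; rewrite -ltNge.
  by apply/negligibleP => //; exact/Gm/GB.
have B1 k : P (B k) = 1%E.
  by have [B0|//] := F0 _ (GB k); exfalso; apply: none; exists k.
have ncap : P.-negligible (\bigcup_k ~` B k).
  apply: negligible_bigcup => k; have mB := Gm _ (GB k).
  have PC : P (~` B k) = 0%E by rewrite probability_setC// B1 subee.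
  by apply/negligibleP => //; exact: measurableC.
have Xoo' : {ae P, forall w, ~ (X w < +oo)%E}.
  apply: negligibleS ncap => w /= /contrapT lt.
  exists (Num.truncn `|fine (X w)|).+1 => //=; apply/negP; rewrite -leNgt.
  move: lt; case: (X w) => [r _| //|_]; last exact: leNye.
  by rewrite lee_fin (le_trans (ler_norm _))// ltW// truncnS_gt.
have NT : P.-negligible [set: Omega].
  have := negligibleU Xoo Xoo'; apply: negligibleS => w _ /=.
  by have [?|?] := pselect (X w < +oo)%E; [right|left].
have PT0 : P [set: Omega] = 0%E by exact: measure_negligible NT.
by have /eqP := probability_setT P; rewrite PT0 eq_sym onee_eq0.
Qed.

Lemma stopping_time_measurable_fun tau : stopping_time F T tau ->
  measurable_fun setT tau.
Proof.
move=> st; apply: (measurability _ (RGenOInfty.measurableE R)) => //.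
move=> _ [_ [x ->] <-]; rewrite setTI.
have := measurableC (stopping_time_le_measurable x st); congr measurable.
apply/seteqP; split => w /=; rewrite in_itv/= andbT ltNge; last by move/negP.
by move=> h; apply/negP.
Qed.

End stopping_times.

(** * Snell envelopes *)

Section snell.
Context {d : measure_display} {Omega : measurableType d} {R : realType}.
Variables (P : probability Omega R) (F : R -> set (set Omega)) (T : R).
Hypothesis hF : usual_filtration P F T.
Implicit Types (th tau sigma rho : Omega -> R) (A B : set Omega).
Local Open Scope ereal_scope.

(** The consistency half of [admissible], isolated because the recursion does not assert it for the
    envelopes. *)
Definition local_family (phi : (Omega -> R) -> Omega -> \bar R) :=
  forall th th', stopping_time F T th -> stopping_time F T th' ->
    {ae P, forall w, th w = th' w -> phi th w = phi th' w}.

(** The optimal stopping problem with reward [phi]: the step common to both recursions of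
    [JJ'_families]. *)
Definition snell_envelope (phi v : (Omega -> R) -> Omega -> \bar R) :=
  forall th, stopping_time F T th ->
    exists C : (Omega -> R) -> Omega -> \bar R,
      (forall tau, stopping_after P F T th tau ->
         cond_exp P (F_at F T th) (phi tau) (C tau)) /\
      is_ess_sup P (stopping_after P F T th) C (v th).

Lemma integral_splitC A (f : Omega -> \bar R) : measurable A ->
  measurable_fun setT f ->
  \int[P]_w f w = \int[P]_(w in A) f w + \int[P]_(w in ~` A) f w.
Proof.
move=> mA mf; rewrite -integral_setU ?setUv//; first exact: measurableC.
by apply/disj_setPS => w [].
Qed.

Lemma stopping_after_trans th rho tau : stopping_after P F T th rho ->
  stopping_after P F T rho tau -> stopping_after P F T th tau.
Proof.
move=> [_ h1] [st h2]; split => //; move: h1 h2; apply: filterS2 => w.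
exact: le_trans.
Qed.

Variables phi v : (Omega -> R) -> Omega -> \bar R.
Hypothesis iphi : forall tau, stopping_time F T tau -> P.-integrable setT (phi tau).
Hypothesis lphi : local_family phi.
Hypothesis phiT : {ae P, forall w, 0 <= phi (fun=> T) w}.
Hypothesis snellv : snell_envelope phi v.
Hypothesis iv : forall th, stopping_time F T th -> P.-integrable setT (v th).

Lemma integral_le_snell th tau A : stopping_time F T th ->
  stopping_after P F T th tau -> F_at F T th A ->
  \int[P]_(w in A) phi tau w <= \int[P]_(w in A) v th w.
Proof.
move=> sth stau FA; have [C [CE [_ [Cv _]]]] := snellv sth.
have cG := F_at_complete hF sth; have [_ Gm _] := cG.
have [_ iC CA] := integrable_cond_expP cG (iphi (proj1 stau)) (CE _ stau).
rewrite -CA//; apply: ae_le_integral; [exact: Gm|by []|exact: iv|].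
by apply: filterS (Cv _ stau) => w.
Qed.

(** The conditional rewards are upward directed: follow [tau] where its version is at least as large
    as that of [tau'], and [tau'] elsewhere. *)
Lemma snell_meas_approx th : stopping_time F T th ->
  meas_wrt (F_at F T th) (v th) /\
  forall e : R, (0 < e)%R -> exists2 tau, stopping_after P F T th tau &
    \int[P]_w v th w <= \int[P]_w phi tau w + e%:E.
Proof.
move=> sth; have [C [CE Cv]] := snellv sth.
have cG := F_at_complete hF sth; have [sG Gm _] := cG.
have ceC tau : stopping_after P F T th tau ->
    integrable_cond_exp P (F_at F T th) (phi tau) (C tau).
  by move=> st; apply: integrable_cond_expP (CE _ st) => //; exact: iphi (proj1 st).
have aT := stopping_afterT hF sth.
have [|||| GV approx] := ess_sup_directed cG Cv (iv sth) _ _ aT.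
- by move=> tau /ceC[].
- by move=> tau /ceC[].
(* Waiting until [T] supplies the nonnegative member that [ess_sup_directed] asks for. *)
- have [GT iT ET] := ceC _ aT.
  have G0 : meas_wrt (F_at F T th) (cst 0 : Omega -> \bar R).
    by apply/meas_wrtP => //; exact: measurable_cst.
  have : {ae P, forall w, setT w -> cst 0 w <= C (fun=> T) w}.
    apply: (ae_le_of_subalg cG) => //; first exact: subalgT.
      exact: integrable0.
    move=> B GB _; rewrite ET//; apply: ae_le_integral; [exact: Gm|exact: integrable0| |].
      exact: iphi (proj1 aT).
    by apply: filterS phiT => w.
  by apply: filterS => w /(_ Logic.I).
- move=> tau tau' st st'; have [Gt it Et] := ceC _ st; have [Gt' it' Et'] := ceC _ st'.
  pose A := ~` [set w | C tau w < C tau' w].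
  have GA : F_at F T th A by apply: subalgC => //; exact: subalg_lt.
  have sk := paste_stopping_after hF sth GA st st'.
  have [Gk ik Ek] := ceC _ sk.
  have le1 : {ae P, forall w, A w -> C tau w <= C (paste A tau tau') w}.
    apply: (ae_le_of_subalg cG) => // B GB BA; rewrite Et// Ek//.
    have mB := Gm _ GB; apply: ae_le_integral => //; [exact: iphi (proj1 st)|exact: iphi (proj1 sk)|].
    apply: filterS (lphi (proj1 st) (proj1 sk)) => w h Bw.
    by rewrite h// pasteT//; exact: BA.
  have le2 : {ae P, forall w, (~` A) w -> C tau' w <= C (paste A tau tau') w}.
    apply: (ae_le_of_subalg cG) => //; first exact: subalgC.
    move=> B GB BA; rewrite Et'// Ek//.
    have mB := Gm _ GB; apply: ae_le_integral => //; [exact: iphi (proj1 st')|exact: iphi (proj1 sk)|].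
    apply: filterS (lphi (proj1 st') (proj1 sk)) => w h Bw.
    by rewrite h// pasteN//; exact: BA.
  exists (paste A tau tau') => //; move: le1 le2; apply: filterS2 => w.
  rewrite /A /= ge_max; have [lt|ge] := ltP (C tau w) (C tau' w).
    move=> _ h2; have {}h2 := h2 (fun k => k isT).
    by rewrite h2 (le_trans (ltW lt)).
  by move=> h1 _; have {}h1 := h1 notF; rewrite h1 (le_trans ge).
split => // e /approx[tau st le]; exists tau => //.
have [_ _ E] := ceC _ st; rewrite -E//; exact: subalgT.
Qed.

(** Take [tau] after [rho] that attains [v rho] in mean up to [e]. Off [A] the reward cannot exceed
    [v rho] in integral, so the loss on [A] is at most [e]. On [A] the reward is bounded by [v th],
    since [tau] also comes after [th]. *)
Lemma snell_supermartingale th rho A : stopping_time F T th ->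
  stopping_after P F T th rho -> F_at F T th A ->
  \int[P]_(w in A) v rho w <= \int[P]_(w in A) v th w.
Proof.
move=> sth thrho FA; have [srho _] := thrho.
have FrA : F_at F T rho A by apply: (F_at_le hF sth srho) FA; exact: proj2 thrho.
have [sG Gm _] := F_at_complete hF srho.
have mA := Gm _ FrA; have mC := measurableC mA.
have [_ approx] := snell_meas_approx srho.
apply/lee_addgt0Pr => e e0; have [tau rhotau le] := approx e e0.
have stau := proj1 rhotau.
rewrite (integral_splitC mA (measurable_int P (iv srho))) in le.
rewrite (integral_splitC mA (measurable_int P (iphi stau))) in le.
have leC := integral_le_snell srho rhotau (subalgC sG FrA).
have leA := integral_le_snell sth (stopping_after_trans thrho rhotau) FA.
have fin f B : P.-integrable setT f -> measurable B ->
    \int[P]_(w in B) f w \is a fin_num.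
  by move=> ? ?; apply: integrable_fin_num => //; exact: integrableTS.
move: le leC leA.
rewrite -(fineK (fin _ _ (iv srho) mA)) -(fineK (fin _ _ (iv srho) mC)).
rewrite -(fineK (fin _ _ (iv sth) mA)) -(fineK (fin _ _ (iphi stau) mA)).
rewrite -(fineK (fin _ _ (iphi stau) mC)) -!EFinD !lee_fin => l1 l2 l3.
lra.
Qed.

(** On [A], where the two times agree, a stopping time after [th] can be kept, and replaced by [T]
    off [A]; the result comes after [th']. Test sets inside [A] belong to both sigma-algebras. *)
Lemma snell_local_le th th' : stopping_time F T th -> stopping_time F T th' ->
  {ae P, forall w, th w = th' w -> v th w <= v th' w}.
Proof.
move=> sth sth'; pose A := [set w | th w = th' w].
have FA : F_at F T th A by exact: (F_at_eq hF).
have [C [CE [_ [_ Cmin]]]] := snellv sth.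
have cG := F_at_complete hF sth; have [sG Gm _] := cG.
have mA := Gm _ FA.
have [Gv' _] := snell_meas_approx sth'.
have mv' := meas_wrt_measurable (F_at_complete hF sth') Gv'.
(* With [c = +oo] this is a competitor for the essential supremum, with nothing to check off [A].
   With [c = 0] it serves to show that the test set [B] below belongs to [F_at F T th]. *)
pose glue (c : \bar R) w := if `[< A w >] then v th' w else c.
have glueE c D : glue c @^-1` D = (A `&` v th' @^-1` D) `|` (~` A `&` (cst c) @^-1` D).
  apply/seteqP; split => w; rewrite /glue /preimage /=.
    by case: asboolP => Aw Dw; [left|right].
  by case: asboolP => Aw [[]|[]].
have Gglue : meas_wrt (F_at F T th) (glue 0).
  move=> D mD; rewrite glueE; apply: subalgU => //.
    apply: (F_at_eqS (th := th')) => //; first by move=> w [].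
    have [sG' _ _] := F_at_complete hF sth'.
    apply: subalgI => //; last exact: Gv'.
    by apply: (F_at_eqS (th := th)) => //; exact: FA.
  apply: subalgI => //; first exact: subalgC.
  suff : meas_wrt (F_at F T th) (cst 0 : Omega -> \bar R) by exact.
  by apply/meas_wrtP => //; exact: measurable_cst.
have mglue : measurable_fun setT (glue +oo).
  move=> _ D mD; rewrite setTI glueE; apply: measurableU; apply: measurableI => //.
  - by rewrite -[X in measurable X]setTI; exact: mv'.
  - exact: measurableC.
  - by rewrite -[X in measurable X]setTI; exact: measurable_cst.
have : {ae P, forall w, v th w <= glue +oo w}.
  apply: Cmin => // tau atau; have stau := proj1 atau.
  have [Gt it Et] := integrable_cond_expP cG (iphi stau) (CE _ atau).
  suff : {ae P, forall w, A w -> C tau w <= v th' w}.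
    by apply: filterS => w h; rewrite /glue; case: asboolP => // _; exact: leey.
  apply: ae_le_of_integral => //; first exact: iv.
  set B := _ `&` _.
  have FB : F_at F T th B.
    rewrite (_ : B = A `&` [set w | glue 0 w < C tau w]).
      by apply: subalgI => //; exact: subalg_lt.
    by apply/seteqP; split => w /= [Aw]; rewrite /glue asboolT.
  have FB' : F_at F T th' B by apply: (F_at_eqS (th := th)) FB => // w [].
  have mB := Gm _ FB.
  have sk := paste_stopping_after hF sth FA atau (stopping_afterT hF sth).
  have sk' : stopping_after P F T th' (paste A tau (fun=> T)).
    split; first exact: proj1 sk.
    apply: filterS (proj2 atau) => w le; rewrite /paste; case: asboolP => [<-//|_].
    by have [h _] := sth'; case/andP: (h w).
  rewrite Et//; apply: le_trans (integral_le_snell sth' sk' FB').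
  apply: ae_le_integral => //; [exact: iphi|exact: iphi (proj1 sk)|].
  apply: filterS (lphi stau (proj1 sk)) => w h [Aw _].
  by rewrite h// pasteT.
by apply: filterS => w + Aw; rewrite /glue asboolT.
Qed.

Lemma snell_local : local_family v.
Proof.
move=> th th' sth sth'; move: (snell_local_le sth sth') (snell_local_le sth' sth).
apply: filterS2 => w h1 h2 e; apply/eqP; rewrite eq_le h1//.
exact: h2.
Qed.

Lemma snell_ge th : stopping_time F T th -> meas_wrt (F_at F T th) (phi th) ->
  {ae P, forall w, phi th w <= v th w}.
Proof.
move=> sth Gphi; have cG := F_at_complete hF sth; have [sG Gm _] := cG.
have : {ae P, forall w, setT w -> phi th w <= v th w}.
  apply: (ae_le_of_subalg cG) => //; first exact: subalgT.
  - by case: (snell_meas_approx sth).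
  - exact: iphi.
  - exact: iv.
  - by move=> B FB _; apply: integral_le_snell => //; exact: stopping_after_refl.
by apply: filterS => w /(_ Logic.I).
Qed.

End snell.

(** * Coupled envelopes *)

Section mutual_envelopes.
Context {d : measure_display} {Omega : measurableType d} {R : realType}.
Variables (P : probability Omega R) (F : R -> set (set Omega)) (T : R).
Hypothesis hF : usual_filtration P F T.
Implicit Types (th tau sigma rho : Omega -> R) (A B : set Omega).
Local Open Scope ereal_scope.
Local Notation family := ((Omega -> R) -> Omega -> \bar R).
Implicit Types (a b phi v : family) (U : nat -> family).

Let s0 : stopping_time F T (fun=> 0%R).
Proof. by case: hF => /ltW T0 _; exact: cst_stopping_time hF _ (lexx _) T0. Qed.

Let sT : stopping_time F T (fun=> T).
Proof. by case: hF => /ltW T0 _; exact: cst_stopping_time hF _ T0 (lexx _). Qed.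

Lemma snell_measurable phi v th : snell_envelope P F T phi v ->
  stopping_time F T th -> measurable_fun setT (v th).
Proof. by move=> sv /sv[C [_ []]]. Qed.

Lemma snell_mono phi phi' v v' th :
  (forall tau, stopping_time F T tau -> measurable_fun setT (phi tau)) ->
  (forall tau, stopping_time F T tau -> measurable_fun setT (phi' tau)) ->
  (forall tau, stopping_time F T tau -> {ae P, forall w, phi tau w <= phi' tau w}) ->
  snell_envelope P F T phi v -> snell_envelope P F T phi' v' ->
  stopping_time F T th -> {ae P, forall w, v th w <= v' th w}.
Proof.
move=> mphi mphi' le sv sv' sth.
have [C [CE [_ [_ Cmin]]]] := sv _ sth.
have [C' [CE' [mv' [Cub' _]]]] := sv' _ sth.
apply: Cmin => // tau atau; have stau := proj1 atau.
have := cond_exp_le (F_at_complete hF sth) (mphi _ stau) (mphi' _ stau)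
  (CE _ atau) (CE' _ atau) (le _ stau).
by move: (Cub' _ atau); apply: filterS2 => w /[swap]; exact: le_trans.
Qed.

Lemma snell_ge0 phi v th : measurable_fun setT (phi (fun=> T)) ->
  {ae P, forall w, 0 <= phi (fun=> T) w} -> snell_envelope P F T phi v ->
  stopping_time F T th -> {ae P, forall w, 0 <= v th w}.
Proof.
move=> mphi phi0 sv sth; have [C [CE [_ [Cub _]]]] := sv _ sth.
have aT := stopping_afterT hF sth; have cG := F_at_complete hF sth.
have [sG _ _] := cG.
have c0 : cond_exp P (F_at F T th) (cst 0) (cst 0).
  have c00 (X : Omega -> \bar R) : X = cst 0 -> cond_exp_nonneg P (F_at F T th) X (cst 0).
    by move=> ->; split=> //; apply/meas_wrtP => //; exact: measurable_cst.
  exists (cst 0), (cst 0); split; first by apply: c00; apply/funext => w; rewrite funeposE maxxx.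
  split; first by apply: c00; apply/funext => w; rewrite funenegE oppe0 maxxx.
  by apply: aeW => w; rewrite subee.
have := cond_exp_le cG (@measurable_cst _ _ _ _ _ _) mphi c0 (CE _ aT) phi0.
by move: (Cub _ aT); apply: filterS2 => w /[swap]; exact: le_trans.
Qed.

(** The conditions shared by [xi] and [- zeta]. *)
Definition reward a := [/\ admissible P F T a, neg_part_ess_sup_integrable P F T a &
  {ae P, forall w, a (fun=> T) w = 0}].

Lemma reward_measurable a tau : reward a -> stopping_time F T tau ->
  measurable_fun setT (a tau).
Proof.
by move=> [[ma _] _ _] st; exact: meas_wrt_measurable (F_at_complete hF st) (ma _ st).
Qed.

(** The recursion for [J] and [J'] with [a = xi] and [b = - zeta], in a form invariant under
    exchanging the players. *)
Definition mutual_envelopes a b U U' :=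
  [/\ forall th w, U 0%N th w = 0, forall th w, U' 0%N th w = 0,
    forall n, snell_envelope P F T (fun tau w => U' n tau w + a tau w) (U n.+1) &
    forall n, snell_envelope P F T (fun tau w => U n tau w + b tau w) (U' n.+1)].

Lemma mutual_envelopesC a b U U' :
  mutual_envelopes a b U U' -> mutual_envelopes b a U' U.
Proof. by move=> [? ? ? ?]; split. Qed.

Lemma mutual_measurable a b U U' n th : mutual_envelopes a b U U' ->
  stopping_time F T th -> measurable_fun setT (U n th).
Proof.
move=> [U0 _ sU _] sth; case: n => [|n]; last exact: snell_measurable (sU n) sth.
by rewrite (_ : U 0%N th = cst 0); [exact: measurable_cst|exact/funext].
Qed.

Lemma mutual_sum_measurable a b U U' n th : reward a -> mutual_envelopes a b U U' ->
  stopping_time F T th -> measurable_fun setT (fun w => U' n th w + a th w).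
Proof.
move=> ra /mutual_envelopesC mU sth; apply: emeasurable_funD.
  exact: mutual_measurable mU sth.
exact: reward_measurable.
Qed.

(** Waiting until [T] earns [U' n] there, the reward itself being zero. The induction exchanges the
    players at each step, hence the quantification over [a], [b], [U], [U']. *)
Lemma mutual_ge0 a b U U' n th : reward a -> reward b -> mutual_envelopes a b U U' ->
  stopping_time F T th -> {ae P, forall w, 0 <= U n th w}.
Proof.
elim: n th a b U U' => [|n IH] th a b U U' ra rb mU sth.
  by case: mU => U0 _ _ _; apply: aeW => w; rewrite U0.
have [_ _ sU _] := mU; apply: (snell_ge0 _ _ (sU n) sth).
  exact: mutual_sum_measurable mU _.
have [_ _ aT] := ra.
move: aT (IH _ b a U' U rb ra (mutual_envelopesC mU) sT); apply: filterS2 => w.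
by rewrite /= => ->; rewrite adde0.
Qed.

Lemma mutual_nd a b U U' n th : reward a -> reward b -> mutual_envelopes a b U U' ->
  stopping_time F T th -> {ae P, forall w, U n th w <= U n.+1 th w}.
Proof.
elim: n th a b U U' => [|n IH] th a b U U' ra rb mU sth.
  have := mutual_ge0 1 ra rb mU sth.
  by case: mU => U0 _ _ _; apply: filterS => w; rewrite U0.
have [_ _ sU _] := mU; apply: (snell_mono _ _ _ (sU n) (sU n.+1) sth) => tau st.
- exact: mutual_sum_measurable mU _.
- exact: mutual_sum_measurable mU _.
- have := IH _ b a U' U rb ra (mutual_envelopesC mU) st.
  by apply: filterS => w ?; exact: leeD.
Qed.

Lemma mutual_nondecreasing a b U U' th : reward a -> reward b ->
  mutual_envelopes a b U U' -> stopping_time F T th ->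
  {ae P, forall w, {homo (fun n => U n th w) : n m / (n <= m)%N >-> n <= m}}.
Proof.
move=> ra rb mU sth; have : {ae P, forall w, forall n, U n th w <= U n.+1 th w}.
  by apply: ae_foralln => n; exact: mutual_nd mU sth.
by apply: filterS => w h; apply/nondecreasing_seqP.
Qed.

(** The negative part of the obstacle is controlled by that of [a], its positive part by the finite
    envelope at time [0]. Finiteness of [U] yields integrability of the other family [U'], because
    [U'] enters the obstacle of [U]. *)
Lemma mutual_integrable a b U U' tau : reward a -> reward b ->
  mutual_envelopes a b U U' ->
  (forall n, {ae P, forall w, U n (fun=> 0%R) w < +oo}) ->
  stopping_time F T tau ->
  P.-integrable setT (a tau) /\ forall n, P.-integrable setT (U' n tau).
Proof.
move=> ra rb mU Uoo st; have [_ U'0 sU _] := mU.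
have ma := reward_measurable ra st; have [_ [Z [[mZ [Zub _]] iZ]] _] := ra.
have iphi n : P.-integrable setT (fun w => U' n tau w + a tau w).
  set X := fun w => _.
  have mX : measurable_fun setT X by exact: mutual_sum_measurable mU _.
  have [C [CE [_ [Cub _]]]] := sU n _ s0.
  have cG := F_at_complete hF s0; have [sG _ _] := cG.
  have a0 := stopping_after0 P st.
  have [Yp [Ym [[Gp [p0 pE]] [[Gm [m0 mE]] YE]]]] := CE _ a0.
  (* Since [U' n tau >= 0] a.e., the negative part of the sum is at most that of [a tau], hence at
     most [Z]. *)
  have Xneg : \int[P]_w X^\- w < +oo.
    apply: (@le_lt_trans _ _ (\int[P]_w maxe (Z w) 0)).
      apply: ae_ge0_le_integral => //.
      - exact: measurable_funeneg.
      - by move=> w _; rewrite le_max lexx orbT.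
      - exact: measurable_maxe.
      - move: (Zub _ st) (mutual_ge0 n rb ra (mutual_envelopesC mU) st).
        apply: filterS2 => w h h0 _; rewrite le_max; apply/orP; left.
        apply: le_trans h; rewrite !funenegE le_max2// leeN2.
        by rewrite leeDr.
    apply: le_lt_trans iZ; rewrite (ae_eq_integral_on _ _ mZ)//.
      exact: measurable_maxe.
    apply: filterS (Zub _ st) => w h _; apply/max_idPl; apply: le_trans h.
    by rewrite funenegE le_max lexx orbT.
  have im : P.-integrable setT Ym.
    apply: ge0_integrable => //; first exact: meas_wrt_measurable cG Gm.
    by rewrite mE//; exact: subalgT.
  (* The version [Yp - Ym] is dominated by [U n.+1] at time [0], which is below [+oo], and [Ym] is
     finite a.e. Triviality of [F 0] then upgrades finiteness of [Yp] to a constant bound. *)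
  have Ypoo : {ae P, forall w, Yp w < +oo}.
    have lt : {ae P, forall w, Yp w - Ym w < +oo}.
      move: YE (Cub _ a0) (Uoo n.+1); apply: filterS3 => w <-.
      exact: le_lt_trans.
    move: lt (integrable_ae measurableT im); apply: filterS2 => w + /(_ Logic.I).
    by move: (p0 w); case: (Yp w) => [p| |]; case: (Ym w) => [m| |] //=; rewrite ?ltry.
  have [c cP] := F_at0_bounded hF Gp Ypoo.
  have ip : \int[P]_w Yp w < +oo.
    apply: (@le_lt_trans _ _ (\int[P]_w maxe c%:E 0)).
      apply: ae_ge0_le_integral => //.
      - exact: meas_wrt_measurable cG Gp.
      - by move=> w _; rewrite le_max lexx orbT.
      - by apply: filterS cP => w h _; rewrite le_max h.
    by rewrite -EFin_max integral_cst// [X in _ * X](probability_setT P) mule1 ltry.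
  apply/integrableP; split => //.
  rewrite -/(abse \o X) fune_abse ge0_integralD//; last 2 first.
  - exact: measurable_funepos.
  - exact: measurable_funeneg.
  by rewrite -(pE _ (subalgT sG)) lte_add_pinfty.
(* As [U' 0 = 0], the obstacle of index [0] is [a] itself; subtracting it from the others leaves
   [U' n]. *)
have ia : P.-integrable setT (a tau).
  apply: eq_integrable (iphi 0%N) => // w _.
  by rewrite U'0 add0e.
split => // n; apply: (integrable_ae_eq (integrableB measurableT (iphi n) ia)).
  exact: mutual_measurable (mutual_envelopesC mU) st.
by apply: filterS (integrable_ae measurableT ia) => w /(_ Logic.I) afin; rewrite addeK.
Qed.

End mutual_envelopes.

(** * Envelopes of integrable rewards and the one-sided bound on the payoff *)

Section integrable_envelopes.
Context {d : measure_display} {Omega : measurableType d} {R : realType}.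
Variables (P : probability Omega R) (F : R -> set (set Omega)) (T : R).
Hypothesis hF : usual_filtration P F T.
Implicit Types (th tau sigma rho : Omega -> R) (A B : set Omega).
Local Open Scope ereal_scope.
Local Notation family := ((Omega -> R) -> Omega -> \bar R).
Implicit Types (a b phi v : family) (U : nat -> family).

Let sT : stopping_time F T (fun=> T).
Proof. by case: hF => /ltW T0 _; exact: cst_stopping_time hF _ T0 (lexx _). Qed.

Definition integrable_envelopes a b U U' :=
  [/\ reward P F T a, reward P F T b, mutual_envelopes P F T a b U U',
    forall tau, stopping_time F T tau ->
      P.-integrable setT (a tau) /\ forall n, P.-integrable setT (U n tau) &
    forall tau, stopping_time F T tau ->
      P.-integrable setT (b tau) /\ forall n, P.-integrable setT (U' n tau)].

Lemma integrable_envelopesC a b U U' :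
  integrable_envelopes a b U U' -> integrable_envelopes b a U' U.
Proof. by move=> [? ? /mutual_envelopesC ? ? ?]; split. Qed.

Lemma envelope_integrable a b U U' n th : integrable_envelopes a b U U' ->
  stopping_time F T th -> P.-integrable setT (U n th).
Proof. by move=> [_ _ _ iU _] /iU[_]. Qed.

Lemma obstacle_integrable a b U U' n tau : integrable_envelopes a b U U' ->
  stopping_time F T tau -> P.-integrable setT (fun w => U' n tau w + a tau w).
Proof.
move=> [_ _ _ iU iU'] st; apply: integrableD => //.
  exact: (iU' _ st).2.
exact: (iU _ st).1.
Qed.

Lemma obstacle_terminal a b U U' n : integrable_envelopes a b U U' ->
  {ae P, forall w, 0 <= U' n (fun=> T) w + a (fun=> T) w}.
Proof.
move=> [ra rb mU _ _]; have [_ _ aT] := ra.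
move: aT (mutual_ge0 hF n rb ra (mutual_envelopesC mU) sT); apply: filterS2 => w.
by rewrite /= => ->; rewrite adde0.
Qed.

Lemma obstacle_local a b U U' n : integrable_envelopes a b U U' ->
  local_family P F T (U' n) ->
  local_family P F T (fun tau w => U' n tau w + a tau w).
Proof.
move=> [[[_ la] _ _] _ _ _ _] lU' th th' sth sth'.
move: (lU' _ _ sth sth') (la _ _ sth sth'); apply: filterS2 => w h1 h2 e.
by rewrite h1// h2.
Qed.

(** The obstacle of [U n.+1] contains [U' n], so consistency passes from one player to the other
    along the induction. *)
Lemma envelope_local a b U U' n : integrable_envelopes a b U U' ->
  local_family P F T (U n).
Proof.
elim: n a b U U' => [|n IH] a b U U' iU; have [_ _ [U0 _ sU _] _ _] := iU.
  by move=> th th' _ _; apply: aeW => w; rewrite !U0.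
apply: (snell_local hF _ _ _ (sU n)).
- by move=> tau; exact: obstacle_integrable iU.
- exact: obstacle_local iU (IH _ _ _ _ (integrable_envelopesC iU)).
- exact: obstacle_terminal iU.
- by move=> th; exact: envelope_integrable iU.
Qed.

Lemma envelope_meas a b U U' n th : integrable_envelopes a b U U' ->
  stopping_time F T th -> meas_wrt (F_at F T th) (U n th).
Proof.
move=> iU sth; have [_ _ [U0 _ sU _] _ _] := iU; case: n => [|n].
  rewrite (_ : U 0%N th = cst 0); last exact/funext.
  have [sG _ _] := F_at_complete hF sth.
  by apply/meas_wrtP => //; exact: measurable_cst.
have [||||//] := @snell_meas_approx _ _ _ _ _ _ hF _ _ _ _ _ (sU n) _ th sth.
- by move=> tau; exact: obstacle_integrable iU.
- exact: obstacle_local iU (envelope_local _ (integrable_envelopesC iU)).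
- exact: obstacle_terminal iU.
- by move=> rho; exact: envelope_integrable iU.
Qed.

Lemma envelope_supermartingale a b U U' n th rho A : integrable_envelopes a b U U' ->
  stopping_time F T th -> stopping_after P F T th rho -> F_at F T th A ->
  \int[P]_(w in A) U n rho w <= \int[P]_(w in A) U n th w.
Proof.
move=> iU; have [_ _ [U0 _ sU _] _ _] := iU; case: n => [|n] sth arho FA.
  by under eq_integral do rewrite U0; under [leRHS]eq_integral do rewrite U0.
apply: (snell_supermartingale hF _ _ _ (sU n)) => //.
- by move=> tau; exact: obstacle_integrable iU.
- exact: obstacle_local iU (envelope_local _ (integrable_envelopesC iU)).
- exact: obstacle_terminal iU.
- by move=> tau; exact: envelope_integrable iU.
Qed.

Lemma integral_obstacle_le a b U U' n th tau A : integrable_envelopes a b U U' ->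
  stopping_time F T th -> stopping_after P F T th tau -> F_at F T th A ->
  \int[P]_(w in A) (U' n tau w + a tau w) <= \int[P]_(w in A) U n.+1 th w.
Proof.
move=> iU sth atau FA; have [_ _ [_ _ sU _] _ _] := iU.
apply: (integral_le_snell hF _ (sU n) _ sth atau FA) => rho.
  exact: obstacle_integrable iU.
exact: envelope_integrable iU.
Qed.

Lemma obstacle_le a b U U' n th : integrable_envelopes a b U U' ->
  stopping_time F T th -> {ae P, forall w, U' n th w + a th w <= U n.+1 th w}.
Proof.
move=> iU sth; have [[[ma _] _ _] _ [_ _ sU _] _ _] := iU.
apply: (@snell_ge _ _ _ _ _ _ hF _ _ _ _ _ (sU n)) => //.
- by move=> tau; exact: obstacle_integrable iU.
- exact: obstacle_local iU (envelope_local _ (integrable_envelopesC iU)).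
- exact: obstacle_terminal iU.
- by move=> tau; exact: envelope_integrable iU.
- have [sG _ _] := F_at_complete hF sth; apply: meas_wrtD => //; last exact: ma.
  exact: envelope_meas (integrable_envelopesC iU) sth.
Qed.

Lemma integral_splitI A B (f : Omega -> \bar R) : measurable A -> measurable B ->
  measurable_fun setT f -> \int[P]_(w in A) f w =
  \int[P]_(w in A `&` B) f w + \int[P]_(w in A `&` ~` B) f w.
Proof.
move=> mA mB mf; rewrite -integral_setU -?setIUr ?setUv ?setIT//.
- exact: measurableI.
- by apply: measurableI => //; exact: measurableC.
- exact: measurable_funTS.
- by apply/disj_setPS => w [[_ ?] []].
Qed.

(* On [B] the player who stops at [tau] receives [a tau]; off [B] the opponent
   has stopped and [- b sigma] dominates [U n.+1 - U' n.+2] at time [rho], where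
   [U n.+1 rho] is still at least the conditional expectation of the obstacle at
   [tau].  The tie [tau = sigma] may be put on either side. *)
Lemma payoff_ge a b U U' n th tau sigma B (X I C : Omega -> \bar R) :
  integrable_envelopes a b U U' -> stopping_time F T th ->
  stopping_after P F T th tau -> stopping_after P F T th sigma ->
  F_at F T (fun w => Num.min (tau w) (sigma w)) B ->
  (forall w, B w -> (tau w <= sigma w)%R) -> (forall w, ~ B w -> (sigma w <= tau w)%R) ->
  P.-integrable setT X ->
  (forall w, B w -> X w = a tau w) -> (forall w, ~ B w -> X w = - b sigma w) ->
  integrable_cond_exp P (F_at F T th) X I ->
  integrable_cond_exp P (F_at F T th) (fun w => U' n tau w + a tau w) C ->
  {ae P, forall w, C w <= I w + U' n.+2 th w}.
Proof.
move=> iU sth atau asigma FB Btau Bsigma iX XB XNB [GI iI EI] [GC iC EC].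
have stau := proj1 atau; have ssigma := proj1 asigma.
have iU' := integrable_envelopesC iU.
have cG := F_at_complete hF sth; have [sG Gm _] := cG.
set rho := fun w => Num.min (tau w) (sigma w).
have srho : stopping_time F T rho by exact: (stopping_time_min hF).
have arho : stopping_after P F T th rho by exact: (stopping_after_min hF).
have arhotau : stopping_after P F T rho tau.
  by split => //; apply: aeW => w; rewrite ge_min lexx.
have [sGr Gmr _] := F_at_complete hF srho.
have mB := Gmr _ FB.
have iU'rho := envelope_integrable n.+2 iU' srho.
have iU'th := envelope_integrable n.+2 iU' sth.
have iphi := obstacle_integrable n iU stau.
have iXU : P.-integrable setT (fun w => X w + U' n.+2 rho w) by exact: integrableD.
(* The comparison takes place at time [rho]: [A] is known at [th] but [B] only at [rho], so the
   descent from [rho] to [th] must wait until both pieces are reassembled. *)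
have main A : F_at F T th A ->
    \int[P]_(w in A) (U' n tau w + a tau w) <= \int[P]_(w in A) (X w + U' n.+2 rho w).
  move=> FA; have mA := Gm _ FA.
  have FrA : F_at F T rho A by apply: (F_at_le hF sth srho) FA; exact: proj2 arho.
  rewrite (integral_splitI mA mB (measurable_int P iphi)).
  rewrite (integral_splitI mA mB (measurable_int P iXU)); apply: leeD.
    apply: ae_le_integral => //; first exact: measurableI.
    have [ra rb mU _ _] := iU.
    move: (mutual_nondecreasing hF rb ra (mutual_envelopesC mU) stau).
    move: (envelope_local n.+2 iU' srho stau); apply: filterS2 => w + h [_ Bw].
    rewrite /rho (min_idPl (Btau _ Bw)) => -> //; rewrite XB// [leRHS]addeC.
    by apply: leeD => //; apply: h; rewrite -addn2 leq_addr.
  have FAB : F_at F T rho (A `&` ~` B) by apply: subalgI => //; exact: subalgC.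
  apply: (le_trans (integral_obstacle_le n iU srho arhotau FAB)).
  apply: ae_le_integral => //; [exact: Gmr|exact: envelope_integrable iU srho|].
  have bfin : {ae P, forall w, b sigma w \is a fin_num}.
    have [ib _] := (let: And5 _ _ _ _ h := iU in h) _ ssigma.
    by apply: filterS (integrable_ae measurableT ib) => w /(_ Logic.I).
  (* This is [U n.+1 + b <= U' n.+2] at [sigma], with the finite [b sigma] moved across. *)
  have l1 : {ae P, forall w, ~ B w -> U n.+1 rho w <= - b sigma w + U' n.+2 sigma w}.
    move: (envelope_local n.+1 iU srho ssigma) (obstacle_le n.+1 iU' ssigma) bfin.
    apply: filterS3 => w + h bf nB; rewrite /rho (min_idPr (Bsigma _ nB)) => -> //.
    by rewrite addeC leeBrDr.
  move: (envelope_local n.+2 iU' srho ssigma) l1; apply: filterS2 => w + h [_ nB].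
  by rewrite /rho (min_idPr (Bsigma _ nB)) => -> //; rewrite XNB//; exact: h.
have : {ae P, forall w, setT w -> C w <= I w + U' n.+2 th w}.
  apply: (ae_le_of_subalg cG) => //; first exact: subalgT.
  - by apply: meas_wrtD => //; exact: envelope_meas iU' sth.
  - exact: integrableD.
  - move=> A FA _; have mA := Gm _ FA; rewrite EC// (le_trans (main _ FA))//.
    rewrite integralD//; [|exact: integrableTS..].
    rewrite [leRHS]integralD//; [|exact: integrableTS..].
    rewrite EI//; apply: leeD => //.
    exact: envelope_supermartingale iU' sth arho FA.
by apply: filterS => w /(_ Logic.I).
Qed.

(* [U n] is a supermartingale, so its mean is at most that at time [0], where
   the limit is bounded because [F 0] is trivial. *)
Lemma envelope_limn_esup_lty a b U U' th : integrable_envelopes a b U U' ->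
  {ae P, forall w, limn_esup (fun n => U n (fun=> 0%R) w) < +oo} ->
  stopping_time F T th ->
  {ae P, forall w, limn_esup (fun n => U n th w) < +oo}.
Proof.
move=> iU U0oo sth; have [ra rb mU _ _] := iU.
have s0 : stopping_time F T (fun=> 0%R).
  by case: hF => /ltW T0 _; exact: cst_stopping_time hF _ (lexx _) T0.
have [sG _ _] := F_at_complete hF s0.
have [|c cP] := @F_at0_bounded _ _ _ _ _ _ hF _ _ U0oo.
  apply/meas_wrtP => //; apply: measurable_fun_limn_esup => n.
  by apply/meas_wrtP => //; exact: envelope_meas iU s0.
have int_le n : \int[P]_w U n th w <= c%:E.
  have F0T := subalgT sG.
  apply: (le_trans (envelope_supermartingale n iU s0 (stopping_after0 P sth) F0T)).
  apply: (@le_trans _ _ (\int[P]_w cst c%:E w)).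
    apply: ae_le_integral => //; first exact: envelope_integrable iU s0.
      exact: finite_measure_integrable_cst.
    move: (mutual_nondecreasing hF ra rb mU s0) cP; apply: filterS2 => w nd le _.
    by apply: le_trans le; exact: (limn_esup_ge (u := fun n => U n (fun=> 0%R) w)).
  by rewrite integral_cst// [X in _ * X](probability_setT P) mule1.
have [N [mN PN good]] : {ae P, forall w, 0 <= U 0%N th w /\
    {homo (fun n => U n th w) : n m / (n <= m)%N >-> n <= m}}.
  move: (mutual_ge0 hF 0%N ra rb mU sth) (mutual_nondecreasing hF ra rb mU sth).
  by apply: filterS2.
(* Positivity and monotonicity hold only off the null set [N]; setting the functions to [0] on [N]
   makes both hold everywhere. *)
pose g n := U n th \_ (~` N).
have gE n w : ~ N w -> g n w = U n th w by move=> Nw; rewrite /g patchE mem_set.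
have gN n w : N w -> g n w = 0.
  by move=> Nw; rewrite /g patchE memNset// => /(_ Nw).
have mg n : measurable_fun setT (g n).
  apply/(measurable_restrictT _ _).1; first exact: measurableC.
  by apply: measurable_funTS; exact: measurable_int (envelope_integrable n iU sth).
have nN w : ~ N w -> 0 <= U 0%N th w /\
    {homo (fun n => U n th w) : n m / (n <= m)%N >-> n <= m}.
  by move=> Nw; apply: contrapT => /good.
have ndg w : {homo g ^~ w : n m / (n <= m)%N >-> n <= m}.
  move=> n m nm; have [Nw|Nw] := pselect (N w); first by rewrite !gN.
  by rewrite !gE//; exact: (nN _ Nw).2.
have g0 n w : 0 <= g n w.
  have [Nw|Nw] := pselect (N w); first by rewrite gN.
  by apply: le_trans (ndg w 0%N n _) => //; rewrite gE//; exact: (nN _ Nw).1.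
have gU n : {ae P, forall w, g n w = U n th w}.
  by exists N; split => // w /= h; apply: contrapT => Nw; apply: h; exact: gE.
have ig : \int[P]_w limn_esup (g ^~ w) <= c%:E.
  apply: integral_limn_esup_le => // n; apply: le_trans (int_le n).
  rewrite (ae_eq_integral_on _ (mg n) (measurable_int P (envelope_integrable n iU sth)))//.
  by apply: filterS (gU n).
have iG : P.-integrable setT (fun w => limn_esup (g ^~ w)).
  apply: ge0_integrable; first exact: measurable_fun_limn_esup.
    move=> w; apply: le_trans (g0 0%N w) _.
    exact: (limn_esup_ge (u := g ^~ w)).
  by apply: le_lt_trans ig _; exact: ltry.
have gUall : {ae P, forall w, forall n, g n w = U n th w} by exact: ae_foralln.
move: (integrable_ae measurableT iG) gUall; apply: filterS2 => w /(_ Logic.I) fin e.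
rewrite (_ : (fun n => _) = g ^~ w); last by apply/funext => n; rewrite e.
by rewrite ltey_eq fin.
Qed.

End integrable_envelopes.

(** * The value of the game *)

Section value.
Context {d : measure_display} {Omega : measurableType d} {R : realType}.
Variables (P : probability Omega R) (F : R -> set (set Omega)) (T : R).
Hypothesis hF : usual_filtration P F T.
Local Open Scope ereal_scope.
Local Notation family := ((Omega -> R) -> Omega -> \bar R).

(** Only [x] has to be finite: [V] and the limit of [J'] may take infinite values when this is
    applied. *)
Lemma lee_suber_swap (x y z : \bar R) : x \is a fin_num ->
  (y <= x - z) = (z <= x - y).
Proof.
case: x => // r _; case: y => [y| |]; case: z => [z| |] //=;
  rewrite ?leey ?leNye//= -?EFinB ?lee_fin; first lra.
Qed.

Variables (xi zeta : family) (J J' : nat -> family).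
Let mzeta : family := fun th w => - zeta th w.
Hypothesis iJ : integrable_envelopes P F T xi mzeta J J'.
Variables (th : Omega -> R).
Hypothesis sth : stopping_time F T th.
Hypothesis Joo : {ae P, forall w, limn_esup (fun n => J n th w) < +oo}.

Lemma payoff_integrable tau sigma : stopping_time F T tau -> stopping_time F T sigma ->
  P.-integrable setT (payoff xi zeta tau sigma).
Proof.
move=> st ss; have [_ _ _ ix iz] := iJ.
have [ixi _] := ix _ st; have [imz _] := iz _ ss.
have izeta : P.-integrable setT (zeta sigma).
  have := integrableN imz; apply: eq_integrable => // w _ /=.
  by rewrite /mzeta oppeK.
have mpay : measurable_fun setT (payoff xi zeta tau sigma).
  apply: measurable_fun_ifT; last 2 first.
  - exact: measurable_int ixi.
  - exact: measurable_int izeta.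
  by apply: measurable_fun_ler; exact: (stopping_time_measurable_fun hF).
apply: (le_integrable measurableT mpay _
  (integrableD measurableT (integrable_abse ixi) (integrable_abse izeta))) => w _ /=.
rewrite [leRHS]gee0_abs ?adde_ge0// /payoff; case: ifP => _.
  by rewrite leeDl.
by rewrite leeDr.
Qed.


Lemma criterion_ge n C I tau sigma :
  stopping_after P F T th tau -> stopping_after P F T th sigma ->
  cond_exp P (F_at F T th) (payoff xi zeta tau sigma) I ->
  cond_exp P (F_at F T th) (fun w => J' n tau w + xi tau w) C ->
  {ae P, forall w, C w <= I w + J' n.+2 th w}.
Proof.
move=> at_ as_ IE CE; have [st _] := at_; have [ss _] := as_.
have cG := F_at_complete hF sth; have ip := payoff_integrable st ss.
have smin := stopping_time_min hF st ss.
have [sGm _ _] := F_at_complete hF smin.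
apply: (payoff_ge hF (B := ~` [set w | (sigma w < tau w)%R]) iJ sth at_ as_ _ _ _ ip).
- by apply: subalgC => //; exact: (F_at_lt_min hF).
- by move=> w /= /negP; rewrite -leNgt.
- by move=> w /= /contrapT /ltW.
- by move=> w /= /negP; rewrite -leNgt /payoff => ->.
- by move=> w /= /contrapT; rewrite /payoff ltNge => /negbTE ->; rewrite /mzeta oppeK.
- exact: integrable_cond_expP.
- by apply: integrable_cond_expP CE => //; exact: obstacle_integrable iJ st.
Qed.

(** For the player stopping at [sigma] the gain is [- payoff], and a tie counts for the opponent;
    [B] is therefore the strict inequality here, whereas [criterion_ge] includes the tie. *)
Lemma criterion_le n C I tau sigma :
  stopping_after P F T th tau -> stopping_after P F T th sigma ->
  cond_exp P (F_at F T th) (payoff xi zeta tau sigma) I ->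
  cond_exp P (F_at F T th) (fun w => J n sigma w - zeta sigma w) C ->
  {ae P, forall w, C w <= - I w + J n.+2 th w}.
Proof.
move=> at_ as_ IE CE; have [st _] := at_; have [ss _] := as_.
have cG := F_at_complete hF sth; have [sG Gm _] := cG.
have ip := payoff_integrable st ss.
have iJ' := integrable_envelopesC iJ.
have [GI iI EI] := integrable_cond_expP cG ip IE.
apply: (payoff_ge hF (B := [set w | (sigma w < tau w)%R])
  (X := fun w => - payoff xi zeta tau sigma w) iJ' sth as_ at_).
- rewrite (_ : (fun w => _) = (fun w => Num.min (tau w) (sigma w))).
    exact: (F_at_lt_min hF).
  by apply/funext => w; rewrite minC.
- by move=> w /= /ltW.
- by move=> w /= /negP; rewrite -leNgt.
- exact: integrableN ip.
- by move=> w /=; rewrite /payoff ltNge => /negbTE ->.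
- by move=> w /= /negP; rewrite -leNgt /payoff => ->.
- split; first exact: meas_wrtN.
    exact: integrableN iI.
  have intN f A : P.-integrable setT f -> measurable A ->
      \int[P]_(w in A) - f w = - \int[P]_(w in A) f w.
    move=> iF mA; rewrite integralN//; apply: integrable_add_def => //.
    exact: integrableTS.
  by move=> A FA; rewrite !intN ?EI//; exact: Gm.
- by apply: integrable_cond_expP CE => //; exact: obstacle_integrable iJ' ss.
Qed.

Let fin_ae f : P.-integrable setT f -> {ae P, forall w, f w \is a fin_num}.
Proof.
by move=> iF; apply: filterS (integrable_ae measurableT iF) => w /(_ Logic.I).
Qed.

(** Stated for an arbitrary [V] so as to serve both values. The right-hand sides do not depend on
    the stopping time, hence they bound the whole essential supremum that defines [J n.+1] or
    [J' n.+1]. *)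
Lemma value_eq (V : Omega -> \bar R) : measurable_fun setT V ->
  (forall n tau C, stopping_after P F T th tau ->
    cond_exp P (F_at F T th) (fun w => J' n tau w + xi tau w) C ->
    {ae P, forall w, C w <= V w + J' n.+2 th w}) ->
  (forall n sigma C, stopping_after P F T th sigma ->
    cond_exp P (F_at F T th) (fun w => J n sigma w - zeta sigma w) C ->
    {ae P, forall w, C w <= J n.+2 th w - V w}) ->
  {ae P, forall w, limn_esup (fun n => J n th w) - limn_esup (fun n => J' n th w)
    = V w}.
Proof.
move=> mV lowV uppV; have [rx rz mJ _ _] := iJ; have [J0 J'0 sJ sJ'] := mJ.
have mJ' := mutual_envelopesC mJ.
have measJ n : measurable_fun setT (J n th) by exact: (mutual_measurable _ mJ).
have measJ' n : measurable_fun setT (J' n th) by exact: (mutual_measurable _ mJ').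
have le1 : {ae P, forall w, forall n, J n.+1 th w <= V w + J' n.+2 th w}.
  apply: ae_foralln => n; have [C [CE [_ [_ Cmin]]]] := sJ n _ sth.
  apply: Cmin; first exact: emeasurable_funD.
  by move=> tau atau; exact: lowV atau (CE _ atau).
have le2 : {ae P, forall w, forall n, J' n.+1 th w <= J n.+2 th w - V w}.
  apply: ae_foralln => n; have [C [CE [_ [_ Cmin]]]] := sJ' n _ sth.
  apply: Cmin; first by apply: emeasurable_funB.
  by move=> sigma asigma; exact: uppV asigma (CE _ asigma).
have nd1 := mutual_nondecreasing hF rx rz mJ sth.
have nd2 := mutual_nondecreasing hF rz rx mJ' sth.
have {le1} low : {ae P, forall w, limn_esup (fun n => J n th w) -
    limn_esup (fun n => J' n th w) <= V w}.
  move: nd1 nd2 le1; apply: filterS3 => w nd nd' le.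
  set j := limn_esup _; set j' := limn_esup _.
  have j'0 : 0 <= j' by rewrite -(J'0 th w); exact: (limn_esup_ge (u := fun n => J' n th w)).
  have jle : j <= V w + j'.
    apply: limn_esup_le => // n.
    apply: (le_trans (nd n n.+1 (leqnSn n))); apply: (le_trans (le n)).
    by apply: leeD => //; exact: (limn_esup_ge (u := fun n => J' n th w)).
  (* If the limit of [J'] is [+oo], the difference is [-oo] by convention and lies below [V]. *)
  move: j'0 jle; case: j' => [r _|_ _|//].
    by rewrite leeBlDr.
  by rewrite [- +oo]/= addeNy leNye.
have {le2} upp : {ae P, forall w, V w <= limn_esup (fun n => J n th w) -
    limn_esup (fun n => J' n th w)}.
  have ndd : {ae P, forall w, {homo (fun n => J n th w) : n m / (n <= m)%N >-> n <= m}
      /\ {homo (fun n => J' n th w) : n m / (n <= m)%N >-> n <= m}}.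
    by move: nd1 nd2; apply: filterS2.
  move: ndd Joo le2; apply: filterS3 => w [nd nd'].
  set j := limn_esup _; set j' := limn_esup _ => joo le.
  have j0 : 0 <= j by rewrite -(J0 th w); exact: (limn_esup_ge (u := fun n => J n th w)).
  rewrite lee_suber_swap ?ge0_fin_numE//; apply: limn_esup_le => // n.
  apply: (le_trans (nd' n n.+1 (leqnSn n))); apply: (le_trans (le n)).
  by apply: leeB => //; exact: (limn_esup_ge (u := fun n => J n th w)).
move: low upp; apply: filterS2 => w ? ?.
by apply/eqP; rewrite eq_le; apply/andP.
Qed.

Variable I : (Omega -> R) -> (Omega -> R) -> Omega -> \bar R.
Hypothesis IE : criterion_versions P F T xi zeta th I.

Let ae_lower n C tau sigma : stopping_after P F T th tau ->
  stopping_after P F T th sigma ->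
  cond_exp P (F_at F T th) (fun w => J' n tau w + xi tau w) C ->
  {ae P, forall w, C w - J' n.+2 th w <= I tau sigma w}.
Proof.
move=> at_ as_ CE.
have /fin_ae := envelope_integrable n.+2 (integrable_envelopesC iJ) sth.
move: (criterion_ge at_ as_ (IE at_ as_) CE); apply: filterS2 => w le fin.
by rewrite leeBlDr.
Qed.

Let ae_upper n C tau sigma : stopping_after P F T th tau ->
  stopping_after P F T th sigma ->
  cond_exp P (F_at F T th) (fun w => J n sigma w - zeta sigma w) C ->
  {ae P, forall w, I tau sigma w <= J n.+2 th w - C w}.
Proof.
move=> at_ as_ CE; have /fin_ae := envelope_integrable n.+2 iJ sth.
move: (criterion_le at_ as_ (IE at_ as_) CE); apply: filterS2 => w le fin.
by rewrite lee_suber_swap// addeC.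
Qed.

Let low_meas n C tau : stopping_after P F T th tau ->
  cond_exp P (F_at F T th) (fun w => J' n tau w + xi tau w) C ->
  measurable_fun setT (fun w => C w - J' n.+2 th w).
Proof.
move=> [st _] CE; have cG := F_at_complete hF sth.
have [GC _ _] := integrable_cond_expP cG (obstacle_integrable n iJ st) CE.
apply: emeasurable_funB; first exact: meas_wrt_measurable cG GC.
exact: measurable_int (envelope_integrable _ (integrable_envelopesC iJ) sth).
Qed.

Let upp_meas n C sigma : stopping_after P F T th sigma ->
  cond_exp P (F_at F T th) (fun w => J n sigma w - zeta sigma w) C ->
  measurable_fun setT (fun w => J n.+2 th w - C w).
Proof.
move=> [ss _] CE; have cG := F_at_complete hF sth.
have [GC _ _] := integrable_cond_expP cG
  (obstacle_integrable n (integrable_envelopesC iJ) ss) CE.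
apply: emeasurable_funB; last exact: meas_wrt_measurable cG GC.
exact: measurable_int (envelope_integrable _ iJ sth).
Qed.

(** The bounds are rearranged so that one side is a single function free of [V], the form in which
    it can compete against an essential infimum or supremum. *)
Let value_eqB (V : Omega -> \bar R) : measurable_fun setT V ->
  (forall n tau C, stopping_after P F T th tau ->
    cond_exp P (F_at F T th) (fun w => J' n tau w + xi tau w) C ->
    {ae P, forall w, C w - J' n.+2 th w <= V w}) ->
  (forall n sigma C, stopping_after P F T th sigma ->
    cond_exp P (F_at F T th) (fun w => J n sigma w - zeta sigma w) C ->
    {ae P, forall w, V w <= J n.+2 th w - C w}) ->
  {ae P, forall w, limn_esup (fun n => J n th w) - limn_esup (fun n => J' n th w)
    = V w}.
Proof.
move=> mV low upp; apply: value_eq => // n tau C at_ CE.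
  have /fin_ae := envelope_integrable n.+2 (integrable_envelopesC iJ) sth.
  by move: (low _ _ _ at_ CE); apply: filterS2 => w le fin; rewrite -leeBlDr.
have /fin_ae := envelope_integrable n.+2 iJ sth.
by move: (upp _ _ _ at_ CE); apply: filterS2 => w le fin; rewrite lee_suber_swap.
Qed.

(** The lower bound on [I tau sigma] holds for every [sigma], so it survives the infimum. For the
    upper bound, a fixed [sigma] is inserted into the infimum of each [tau]. The value is squeezed
    directly, without being compared to the upper one. *)
Lemma lower_value_eq V : is_lower_value P F T th I V ->
  {ae P, forall w, limn_esup (fun n => J n th w) - limn_esup (fun n => J' n th w)
    = V w}.
Proof.
move=> [Inf [InfE [mV [Vub Vmin]]]]; apply: value_eqB => // n tau C at_ CE.
  have [_ [_ Infmax]] := InfE _ at_.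
  have := Infmax _ (low_meas at_ CE) (fun sigma as_ => ae_lower at_ as_ CE).
  by move: (Vub _ at_); apply: filterS2 => w /[swap]; exact: le_trans.
apply: Vmin => [|rho ar]; first exact: upp_meas at_ CE.
have [_ [Infle _]] := InfE _ ar.
by move: (Infle _ at_) (ae_upper ar at_ CE); apply: filterS2 => w; exact: le_trans.
Qed.

Lemma upper_value_eq V : is_upper_value P F T th I V ->
  {ae P, forall w, limn_esup (fun n => J n th w) - limn_esup (fun n => J' n th w)
    = V w}.
Proof.
move=> [Sup [SupE [mV [Vlb Vmax]]]]; apply: value_eqB => // n tau C at_ CE.
  apply: Vmax => [|rho ar]; first exact: low_meas at_ CE.
  have [_ [Suple _]] := SupE _ ar.
  by move: (ae_lower at_ ar CE) (Suple _ at_); apply: filterS2 => w; exact: le_trans.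
have [_ [_ Supmin]] := SupE _ at_.
have := Supmin _ (upp_meas at_ CE) (fun rho ar => ae_upper ar at_ CE).
by move: (Vlb _ at_); apply: filterS2 => w; exact: le_trans.
Qed.

End value.

Theorem theorem3p2 (d : measure_display) (Omega : measurableType d) (R : realType)
  (P : probability Omega R) (F : R -> set (set Omega)) (T : R)
  (xi zeta : (Omega -> R) -> Omega -> \bar R)
  (J J' : nat -> (Omega -> R) -> Omega -> \bar R) :
  usual_filtration P F T ->
  admissible P F T xi -> admissible P F T zeta ->
  neg_part_ess_sup_integrable P F T xi ->
  neg_part_ess_sup_integrable P F T (fun th w => (- zeta th w)%E) ->
  {ae P, forall w, xi (fun _ => T) w = 0%E} ->
  {ae P, forall w, zeta (fun _ => T) w = 0%E} ->
  JJ'_families P F T xi zeta J J' ->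
  {ae P, forall w, (limn_esup (fun n => J n (fun _ => 0%R) w) < +oo)%E} ->
  right_USCE P F T xi ->
  right_USCE P F T (fun th w => (- zeta th w)%E) ->
  forall th, stopping_time F T th ->
  forall I, criterion_versions P F T xi zeta th I ->
  let Y := fun w => (limn_esup (fun n => J n th w)
                     - limn_esup (fun n => J' n th w))%E in
  (forall V, is_lower_value P F T th I V -> {ae P, forall w, Y w = V w}) /\
  (forall V, is_upper_value P F T th I V -> {ae P, forall w, Y w = V w}).
Proof.
move=> hF axi _ nxi nzeta xiT zetaT [J0 [J'0 [sJ sJ']]] Joo _ [azeta _] th sth I IE Y.
pose mzeta := fun (th : Omega -> R) w => (- zeta th w)%E.
have rx : reward P F T xi by split.
have rz : reward P F T mzeta.
  by split => //; apply: filterS zetaT => w; rewrite /mzeta => ->; rewrite oppe0.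
have mJ : mutual_envelopes P F T xi mzeta J J' by split.
have mJ' := mutual_envelopesC mJ.
have s0 : stopping_time F T (fun=> 0).
  by have [/ltW T0 _] := hF; exact: cst_stopping_time hF _ (lexx _) T0.
have J0oo n : {ae P, forall w, (J n (fun=> 0%R) w < +oo)%E}.
  move: (mutual_nondecreasing hF rx rz mJ s0) Joo; apply: filterS2 => w nd.
  by apply: le_lt_trans; exact: (limn_esup_ge (u := fun n => J n (fun=> 0%R) w)).
have iJ'1 := mutual_integrable hF rx rz mJ J0oo.
(* Integrability of [J' n], drawn from finiteness of [J] at [0], makes [J' n] finite at [0];
   exchanging the players then gives integrability of [- zeta] and of [J n]. *)
have J'0oo n : {ae P, forall w, (J' n (fun=> 0%R) w < +oo)%E}.
  have [_ /(_ n) iJ'0] := iJ'1 _ s0.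
  apply: filterS (integrable_ae measurableT iJ'0) => w /(_ Logic.I) fin.
  by rewrite ltey_eq fin.
have iJ1 := mutual_integrable hF rz rx mJ' J'0oo.
have iJ : integrable_envelopes P F T xi mzeta J J'.
  by split => // tau st; have [? ?] := iJ1 _ st; have [? ?] := iJ'1 _ st.
have Jthoo := envelope_limn_esup_lty hF iJ Joo sth.
split => V; first exact: (lower_value_eq hF iJ sth Jthoo IE).
exact: (upper_value_eq hF iJ sth Jthoo IE).
Qed.
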